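(* Let $p$ be a prime. Let $X$ and $Y$ be connected spaces of the homotopy type of finite CW-complexes and let $f\colon X\to Y$ be a map inducing an isomorphism $\widehat{\pi_1(X)}\to\widehat{\pi_1(Y)}$ on algebraic closures with respect to $\mathbb{Z}_{(p)}$-coefficients. Then $f$ induces a one-to-one correspondence between $p$-towers of $Y$ and $p$-towers of $X$ via pullback; that is, $f$ is a $p$-tower map.
   Context: An abelian $p$-group is a finite abelian group of order a power of $p$. $\mathbb{Z}_p=\mathbb{Z}/p$, and $\mathbb{Z}_{(p)}$ is the localization of $\mathbb{Z}$ at the prime $p$ (all primes other than $p$ inverted). $p$-towers: a $p$-tower of height $n$ of a connected space $X$ is a tower of connected covers $X_n\to\cdots\to X_0=X$ where each $X_{i+1}\to X_i$ is the regular cover determined by a surjection $\pi_1(X_i)\to\Gamma_i$ onto an abelian $p$-group. $p$-tower map: a map $f_0\colon X_0\to Y_0$ is a $p$-tower map if for every $n\ge0$ and all abelian $p$-groups $\Gamma_0,\ldots,\Gamma_n$ the following holds: $f_0^*\colon\operatorname{Hom}(\pi_1(Y_0),\Gamma_0)\to\operatorname{Hom}(\pi_1(X_0),\Gamma_0)$ is a bijection; and inductively for $1\le i\le n$, whenever $Y_i$ and $X_i$ are the covers of $Y_{i-1}$ and $X_{i-1}$ determined by a surjection $\phi_{i-1}\colon\pi_1(Y_{i-1})\to\Gamma_{i-1}$ and by $f_{i-1}^*(\phi_{i-1})$ respectively, the lift $f_i\colon X_i\to Y_i$ of $f_{i-1}$ induces a bijection $f_i^*\colon\operatorname{Hom}(\pi_1(Y_i),\Gamma_i)\to\operatorname{Hom}(\pi_1(X_i),\Gamma_i)$.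 Algebraic closure: a group homomorphism $\pi\to G$ is 2-connected with respect to $\mathbb{Z}_{(p)}$-coefficients if it induces an isomorphism on $H_1(-;\mathbb{Z}_{(p)})$ and a surjection on $H_2(-;\mathbb{Z}_{(p)})$ (for finitely presented groups this is equivalent to the same condition with $\mathbb{Z}_p$-coefficients). A group $A$ is algebraically closed (with respect to $\mathbb{Z}_{(p)}$) if for every homomorphism $\pi\to G$ between finitely presented groups that is 2-connected with respect to $\mathbb{Z}_{(p)}$-coefficients, the induced map $\operatorname{Hom}(G,A)\to\operatorname{Hom}(\pi,A)$ is a bijection. The algebraic closure of a group $G$ is the algebraically closed group $\widehat G$ with a homomorphism $p_G\colon G\to\widehat G$ which is initial among homomorphisms of $G$ into algebraically closed groups; it exists and $G\mapsto\widehat G$ is a functor. *)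

(* Defs.v *)
From HB Require Import structures.
From mathcomp Require Import all_boot all_order all_algebra all_fingroup.
From mathcomp Require Import all_solvable generic_quotient ring_quotient.
From mathcomp Require Import all_classical all_reals topology continuous_path.
From mathcomp Require Import normedtype ring lra.
From mathcomp.multinomials Require Import freeg.

Set Implicit Arguments.
Unset Strict Implicit.
Unset Printing Implicit Defensive.

Import Order.TTheory GRing.Theory Num.Theory.
Import numFieldNormedType.Exports.

Local Open Scope classical_set_scope.
Local Open Scope ring_scope.
Local Open Scope quotient_scope.

Definition unit_interval (R : realType) : Type := set_type `[0 : R, 1].

Section UnitInterval.
Context (R : realType).
Local Notation I := (unit_interval R).

HB.instance Definition _ := Topological.copy I (set_type `[0 : R, 1]).

Definition ival (t : I) : R := sval t.

Lemma ival_itv (t : I) : 0 <= ival t <= 1.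
Proof. by have := set_mem (svalP t); rewrite /= in_itv. Qed.

Lemma clamp_subproof (u : R) : Num.max 0 (Num.min u 1) \in `[0 : R, 1]%classic.
Proof. by apply/mem_set; rewrite /= in_itv /= le_max lexx /= ge_max ler01 ge_min lexx orbT. Qed.

(* the retraction of the real line onto [0, 1] *)
Definition clamp (u : R) : I := exist (fun v => v \in `[0 : R, 1]%classic) _ (clamp_subproof u).

Lemma ival_inj : injective ival.
Proof. exact: val_inj. Qed.

Lemma ivalE u : ival (clamp u) = Num.max 0 (Num.min u 1).
Proof. by []. Qed.

Lemma ivalK : cancel ival clamp.
Proof.
move=> t; apply: ival_inj; rewrite ivalE; have /andP[t0 t1] := ival_itv t.
by rewrite (min_idPl t1) (max_idPr t0).
Qed.

Lemma clampK u : 0 <= u <= 1 -> ival (clamp u) = u.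
Proof. by move=> /andP[u0 u1]; rewrite ivalE (min_idPl u1) (max_idPr u0). Qed.

Lemma clamp_le0 u : u <= 0 -> clamp u = clamp 0.
Proof.
move=> u0; apply: ival_inj; rewrite !ivalE (min_idPl (le_trans u0 ler01)).
by rewrite (min_idPl ler01) maxxx (max_idPl u0).
Qed.

Lemma clamp_ge1 u : 1 <= u -> clamp u = clamp 1.
Proof. by move=> u1; apply: ival_inj; rewrite !ivalE (min_idPr u1) minxx. Qed.

Lemma continuous_ival : continuous ival.
Proof. exact: initial_continuous. Qed.

Lemma continuous_clamp : continuous clamp.
Proof.
apply: continuous_comp_initial => u.
have -> : (fun t : I => sval t) \o clamp = cst 0 \max (idfun \min cst 1) by [].
apply: continuous_max; first exact: cvg_cst.
by apply: continuous_min; [exact: cvg_id|exact: cvg_cst].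
Qed.

Lemma clamp01_neq : clamp 0 != clamp 1.
Proof.
apply/eqP => /(congr1 ival); rewrite !clampK ?lexx ?ler01 // => /eqP.
by rewrite eq_sym oner_eq0.
Qed.

HB.instance Definition _ := isBiPointed.Build I clamp01_neq.

Lemma ival0 : ival zero = 0. Proof. by rewrite clampK ?lexx ?ler01. Qed.
Lemma ival1 : ival one = 1. Proof. by rewrite clampK ?lexx ?ler01. Qed.

End UnitInterval.

Arguments zero : simpl never.
Arguments one : simpl never.
Arguments ival : simpl never.
Arguments clamp : simpl never.

Lemma continuous_glue (R : realType) (T X : topologicalType) (u : T -> R)
    (f g : T -> X) : continuous u -> continuous f -> continuous g ->
  (forall t, u t = 1 -> f t = g t) ->
  continuous (fun t => if u t <= 1 then f t else g t).
Proof.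
move=> cu cf cg fg t U /= nU.
change (nbhs t (fun v => U (if u v <= 1 then f v else g v))).
move: nU; case: (ltgtP (u t) 1) => ut nU.
- have ut' : \near t, u t < 1 by exact: (@cvgr_lt _ _ _ _ _ _ (cu t) _ ut).
  have Ut : \near t, U (f t) by exact: (cf t U nU).
  near=> v; rewrite ifT; first by near: v.
  by apply: ltW; near: v.
- have ut' : \near t, 1 < u t by exact: (@cvgr_gt _ _ _ _ _ _ (cu t) _ ut).
  have Ut : \near t, U (g t) by exact: (cg t U nU).
  near=> v; rewrite ifF; first by near: v.
  by apply/negbTE; rewrite -ltNge; near: v.
- have nU' : nbhs (g t) U by rewrite -fg.
  have Uf : \near t, U (f t) by exact: (cf t U nU).
  have Ug : \near t, U (g t) by exact: (cg t U nU').
  by near=> v; case: ifP => _; near: v.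
Unshelve. all: by end_near. Qed.

Lemma continuous_compT (X Y Z : topologicalType) (f : X -> Y) (g : Y -> Z) :
  continuous g -> continuous f -> continuous (fun x => g (f x)).
Proof. by move=> cg cf x; apply: (continuous_comp (cf x)); exact: cg. Qed.

Lemma continuous_pairT (X Y Z : topologicalType) (f : X -> Y) (g : X -> Z) :
  continuous f -> continuous g -> continuous (fun x => (f x, g x)).
Proof. by move=> cf cg x; apply: cvg_pair; [exact: cf|exact: cg]. Qed.

Lemma continuous_fst (X Y : topologicalType) : continuous (@fst X Y).
Proof. by move=> x; exact: cvg_fst. Qed.

Lemma continuous_snd (X Y : topologicalType) : continuous (@snd X Y).
Proof. by move=> x; exact: cvg_snd. Qed.

Lemma continuous_cstT (X Y : topologicalType) (y : Y) :
  continuous (fun _ : X => y).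
Proof. by move=> t; exact: cvg_cst. Qed.

Section ContinuousReal.
Context (R : realType) (T : topologicalType).
Implicit Types u v : T -> R.

Lemma continuous_addT u v :
  continuous u -> continuous v -> continuous (fun t => u t + v t).
Proof. by move=> cu cv t; exact: (@continuousD R R^o T u v t (cu t) (cv t)). Qed.

Lemma continuous_oppT u : continuous u -> continuous (fun t => - u t).
Proof. by move=> cu t; exact: (@continuousN R R^o T u t (cu t)). Qed.

Lemma continuous_mulT u v :
  continuous u -> continuous v -> continuous (fun t => u t * v t).
Proof. by move=> cu cv t; exact: (@continuousM R T u v t (cu t) (cv t)). Qed.

Lemma continuous_maxT u v :
  continuous u -> continuous v -> continuous (fun t => Num.max (u t) (v t)).
Proof. by move=> cu cv t; exact: (@continuous_max _ _ u v t (cu t) (cv t)). Qed.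

Lemma continuous_minT u v :
  continuous u -> continuous v -> continuous (fun t => Num.min (u t) (v t)).
Proof. by move=> cu cv t; exact: (@continuous_min _ _ u v t (cu t) (cv t)). Qed.

Lemma continuous_scale u (c d : R) :
  continuous u -> continuous (fun t => c * u t + d).
Proof.
move=> cu; apply: continuous_addT; last exact: continuous_cstT.
by apply: continuous_mulT => //; exact: continuous_cstT.
Qed.

End ContinuousReal.

Section Homotopy.
Context (R : realType).
Local Notation I := (unit_interval R).

Definition homotopic (X Y : topologicalType) (f g : X -> Y) : Prop :=
  exists H : I * X -> Y, [/\ continuous H, forall x, H (zero, x) = f x
    & forall x, H (one, x) = g x].

Definition homotopy_equivalent (X Y : topologicalType) : Prop :=
  exists (f : continuousType X Y) (g : continuousType Y X),
    homotopic (g \o f) idfun /\ homotopic (f \o g) idfun.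

Definition path_homotopic (X : topologicalType) (f g : I -> X) : Prop :=
  exists H : I * I -> X,
    [/\ continuous H, forall t, H (zero, t) = f t, forall t, H (one, t) = g t,
        forall s, H (s, zero) = f zero & forall s, H (s, one) = f one].

Lemma continuous_opp_ival : continuous (fun t : I => 1 - ival t).
Proof.
apply: continuous_addT; first exact: continuous_cstT.
exact/continuous_oppT/continuous_ival.
Qed.

Lemma path_homotopic_line (X : topologicalType) (F : R -> X) (a b : I -> R) :
  continuous F -> continuous a -> continuous b ->
  a zero = b zero -> a one = b one -> path_homotopic (F \o a) (F \o b).
Proof.
move=> cF ca cb ab0 ab1.
exists (fun q => F ((1 - ival q.1) * a q.2 + ival q.1 * b q.2)); split => /=.
- have c1 : continuous (fun q : I * I => ival q.1).
    exact: (continuous_compT (@continuous_ival R) (@continuous_fst _ _)).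
  have c2 c : continuous c -> continuous (fun q : I * I => c q.2 : R).
    by move=> cc; exact: (continuous_compT cc (@continuous_snd _ _)).
  apply: (@continuous_compT _ _ _
    (fun q => (1 - ival q.1) * a q.2 + ival q.1 * b q.2) F) => //.
  apply: continuous_addT; apply: continuous_mulT => //; last 2 first.
  + exact: c2.
  + exact: c2.
  apply: continuous_addT; first exact: continuous_cstT.
  exact: continuous_oppT.
- by move=> t; rewrite ival0 subr0 mul1r mul0r addr0.
- by move=> t; rewrite ival1 subrr mul1r mul0r add0r.
- by move=> s; rewrite -ab0 -mulrDl subrK mul1r.
- by move=> s; rewrite -ab1 -mulrDl subrK mul1r.
Qed.

Lemma path_homotopic_refl (X : topologicalType) (f : I -> X) :
  continuous f -> path_homotopic f f.
Proof.
move=> cf; exists (f \o snd); split => //.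
exact: (continuous_compT cf (@continuous_snd _ _)).
Qed.

Lemma path_homotopic_sym (X : topologicalType) (f g : I -> X) :
  path_homotopic f g -> path_homotopic g f.
Proof.
move=> [H [cH H0 H1 Hz Ho]].
exists (fun q => H (clamp (1 - ival q.1), q.2)); split => /=.
- apply: (continuous_compT cH); apply: continuous_pairT; last first.
    exact: continuous_snd.
  apply: (continuous_compT (@continuous_clamp R)).
  exact: (continuous_compT continuous_opp_ival (@continuous_fst _ _)).
- by move=> t; rewrite ival0 subr0 H1.
- by move=> t; rewrite ival1 subrr H0.
- by move=> s; rewrite Hz -H1 Hz.
- by move=> s; rewrite Ho -H1 Ho.
Qed.

Lemma path_homotopic_comp (X Y : topologicalType) (h : X -> Y) (f g : I -> X) :
  continuous h -> path_homotopic f g -> path_homotopic (h \o f) (h \o g).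
Proof.
move=> ch [H [cH H0 H1 Hz Ho]]; exists (h \o H); split => /=.
- exact: continuous_compT ch cH.
- by move=> t; rewrite H0.
- by move=> t; rewrite H1.
- by move=> s; rewrite Hz.
- by move=> s; rewrite Ho.
Qed.

Lemma path_homotopic_trans (X : topologicalType) (f g h : I -> X) :
  path_homotopic f g -> path_homotopic g h -> path_homotopic f h.
Proof.
move=> [H [cH H0 H1 Hz Ho]] [K [cK K0 K1 Kz Ko]].
pose u (d : R) (q : I * I) := 2 * ival q.1 + d.
have cu d : continuous (u d).
  apply: continuous_scale.
  exact: (continuous_compT (@continuous_ival R) (@continuous_fst _ _)).
have cu' d : continuous (fun q => (clamp (u d q), q.2)).
  apply: continuous_pairT; last exact: continuous_snd.
  exact: (continuous_compT (@continuous_clamp R) (cu d)).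
exists (fun q => if u 0 q <= 1 then H (clamp (u 0 q), q.2) else K (clamp (u (-1) q), q.2)); split.
- apply: continuous_glue => //.
  + exact: (continuous_compT cH (cu' _)).
  + exact: (continuous_compT cK (cu' _)).
  + move=> q uq; rewrite uq.
    have -> : u (-1) q = 0 by move: uq; rewrite /u; lra.
    by rewrite H1 K0.
- by move=> t; rewrite /u /= ival0 mulr0 addr0 ler01 H0.
- move=> t; rewrite /u /= ival1 !mulr1 addr0 ifF; last by lra.
  have -> : 2 - 1 = 1 :> R by lra.
  by rewrite K1.
- by move=> s; rewrite /= Hz Kz -H1 Hz; case: ifP.
- by move=> s; rewrite /= Ho Ko -H1 Ho; case: ifP.
Qed.

(* [extend f] is constant outside [0, 1] *)
Definition extend (X : topologicalType) (f : I -> X) (u : R) : X := f (clamp u).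

Definition concat_line (X : topologicalType) (f g : R -> X) (u : R) : X :=
  if u <= 1 then f u else g (u - 1).

Definition concat (X : topologicalType) (f g : I -> X) (t : I) : X :=
  concat_line (extend f) (extend g) (2 * ival t).

Definition reverse (X : topologicalType) (f : I -> X) (t : I) : X :=
  f (clamp (1 - ival t)).

Lemma continuous_extend (X : topologicalType) (f : I -> X) :
  continuous f -> continuous (extend f).
Proof.
by move=> cf; exact: (continuous_compT cf (@continuous_clamp R)).
Qed.

Lemma extend_le0 (X : topologicalType) (f : I -> X) u :
  u <= 0 -> extend f u = f zero.
Proof. by rewrite /extend => /clamp_le0 ->. Qed.

Lemma extend_ge1 (X : topologicalType) (f : I -> X) u :
  1 <= u -> extend f u = f one.
Proof. by rewrite /extend => /clamp_ge1 ->. Qed.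

Lemma extend_ival (X : topologicalType) (f : I -> X) t : extend f (ival t) = f t.
Proof. by rewrite /extend ivalK. Qed.

Lemma continuous_affine_ival (c d : R) : continuous (fun t : I => c * ival t + d).
Proof. exact/continuous_scale/continuous_ival. Qed.

Lemma continuous_concat_line (X : topologicalType) (f g : R -> X) :
  continuous f -> continuous g -> f 1 = g 0 -> continuous (concat_line f g).
Proof.
move=> cf cg fg; apply: continuous_glue => //.
- by move=> u; exact: cvg_id.
- apply: (@continuous_compT _ _ _ (fun u : R => u - 1) g) => //.
  by apply: continuous_addT; [by move=> u; exact: cvg_id|exact: continuous_cstT].
- by move=> u ->; rewrite subrr.
Qed.

Lemma continuous_concat (X : topologicalType) (f g : I -> X) :
  continuous f -> continuous g -> f one = g zero -> continuous (concat f g).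
Proof.
move=> cf cg fg.
apply: (@continuous_compT _ _ _ (fun t : I => 2 * ival t)
  (concat_line (extend f) (extend g))).
  by apply: continuous_concat_line; [exact: continuous_extend..|exact: fg].
by apply: continuous_mulT; [exact: continuous_cstT|exact: continuous_ival].
Qed.

Lemma concat0 (X : topologicalType) (f g : I -> X) : concat f g zero = f zero.
Proof. by rewrite /concat ival0 mulr0 /concat_line ler01. Qed.

Lemma concat1 (X : topologicalType) (f g : I -> X) : concat f g one = g one.
Proof.
rewrite /concat ival1 mulr1 /concat_line ifF; last by lra.
by apply: extend_ge1; lra.
Qed.

Lemma continuous_reverse (X : topologicalType) (f : I -> X) :
  continuous f -> continuous (reverse f).
Proof.
move=> cf.
exact: (continuous_compT (continuous_extend cf) continuous_opp_ival).
Qed.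

Lemma reverse0 (X : topologicalType) (f : I -> X) : reverse f zero = f one.
Proof. by rewrite /reverse ival0 subr0. Qed.

Lemma reverse1 (X : topologicalType) (f : I -> X) : reverse f one = f zero.
Proof. by rewrite /reverse ival1 subrr. Qed.

Lemma path_homotopic_reverse (X : topologicalType) (f g : I -> X) :
  path_homotopic f g -> path_homotopic (reverse f) (reverse g).
Proof.
move=> [H [cH H0 H1 Hz Ho]].
exists (fun q => H (q.1, clamp (1 - ival q.2))); split => /=.
- apply: (continuous_compT cH); apply: continuous_pairT.
    exact: continuous_fst.
  apply: (continuous_compT (@continuous_clamp R)).
  exact: (continuous_compT continuous_opp_ival (@continuous_snd _ _)).
- by move=> t; rewrite H0.
- by move=> t; rewrite H1.
- by move=> s; rewrite ival0 subr0 reverse0 Ho.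
- by move=> s; rewrite ival1 subrr reverse1 Hz.
Qed.

Lemma path_homotopic_concat (X : topologicalType) (f f' g g' : I -> X) :
  f one = g zero -> path_homotopic f f' -> path_homotopic g g' ->
  path_homotopic (concat f g) (concat f' g').
Proof.
move=> fg [H [cH H0 H1 Hz Ho]] [K [cK K0 K1 Kz Ko]].
pose u (d : R) (q : I * I) := 2 * ival q.2 + d.
have cu d : continuous (u d).
  apply: continuous_scale.
  exact: (continuous_compT (@continuous_ival R) (@continuous_snd _ _)).
have cu' d : continuous (fun q => (q.1, clamp (u d q))).
  apply: continuous_pairT; first exact: continuous_fst.
  exact: (continuous_compT (@continuous_clamp R) (cu d)).
exists (fun q => if u 0 q <= 1 then H (q.1, clamp (u 0 q)) else K (q.1, clamp (u (-1) q))); split.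
- apply: continuous_glue => //.
  + exact: (continuous_compT cH (cu' _)).
  + exact: (continuous_compT cK (cu' _)).
  + move=> q uq; rewrite uq.
    have -> : u (-1) q = 0 by move: uq; rewrite /u; lra.
    by rewrite Ho Kz.
- by move=> t; rewrite /u /= addr0 H0 K0.
- by move=> t; rewrite /u /= addr0 H1 K1.
- by move=> s; rewrite /u /= ival0 mulr0 addr0 ler01 Hz concat0.
- move=> s; rewrite /u /= ival1 !mulr1 addr0 ifF; last by lra.
  have -> : 2 - 1 = 1 :> R by lra.
  by rewrite Ko concat1.
Qed.

Lemma concatA (X : topologicalType) (f g h : I -> X) :
  continuous f -> continuous g -> continuous h ->
  f one = g zero -> g one = h zero ->
  path_homotopic (concat f (concat g h)) (concat (concat f g) h).
Proof.
move=> cf cg ch fg gh.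
pose F := concat_line (extend f) (concat_line (extend g) (extend h)).
pose a (t : I) : R := Num.max (2 * ival t + 0) (4 * ival t + -1).
pose b (t : I) : R := Num.min (4 * ival t + 0) (2 * ival t + 1).
have -> : concat f (concat g h) = F \o a.
  apply/funext => t; have := ival_itv t; rewrite /F /a /concat /= /concat_line.
  move=> /andP[t0 t1].
  case: ifPn => [t2|]; first by rewrite max_l ?addr0 ?t2//; lra.
  rewrite -ltNge => t2; rewrite max_r; last by lra.
  rewrite [RHS]ifF; last by apply/negbTE; rewrite -ltNge; lra.
  rewrite {1}/extend clampK; last by lra.
  have -> : 4 * ival t + -1 - 1 = 2 * (2 * ival t - 1) by lra.
  by [].
have -> : concat (concat f g) h = F \o b.
  apply/funext => t; have := ival_itv t; rewrite /F /b /concat /= /concat_line.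
  move=> /andP[t0 t1].
  case: ifPn => [t2|].
    rewrite min_l; last by lra.
    rewrite {1}/extend clampK; last by lra.
    have -> : 4 * ival t + 0 = 2 * (2 * ival t) by lra.
    case: ifPn => // t3; rewrite ifT //; lra.
  rewrite -ltNge => t2; rewrite min_r; last by lra.
  rewrite ifF; last by apply/negbTE; rewrite -ltNge; lra.
  rewrite ifF; last by apply/negbTE; rewrite -ltNge; lra.
  by congr extend; lra.
apply: path_homotopic_line.
- apply: continuous_concat_line; [exact: continuous_extend| |].
    by apply: continuous_concat_line; [exact: continuous_extend..|exact: gh].
  by rewrite /concat_line ler01; exact: fg.
- apply: continuous_maxT; exact: continuous_affine_ival.
- apply: continuous_minT; exact: continuous_affine_ival.
- by rewrite /a /b ival0 max_l ?min_l; lra.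
- by rewrite /a /b ival1 max_r ?min_r; lra.
Qed.

Lemma concat_cst_l (X : topologicalType) (f : I -> X) :
  continuous f -> path_homotopic (concat (cst (f zero)) f) f.
Proof.
move=> cf; pose a (t : I) : R := Num.max 0 (2 * ival t + -1).
have -> : concat (cst (f zero)) f = extend f \o a.
  apply/funext => t; rewrite /concat /= /concat_line /a.
  case: ifPn => t2; first by rewrite max_l ?[RHS]extend_le0 //; lra.
  by rewrite max_r //; lra.
rewrite [X in path_homotopic _ X](_ : f = extend f \o @ival R); last first.
  by apply/funext => t; rewrite /= extend_ival.
apply: path_homotopic_line.
- exact: continuous_extend.
- by apply: continuous_maxT; [exact: continuous_cstT|exact: continuous_affine_ival].
- exact: continuous_ival.
- by rewrite /a ival0 max_l; lra.
- by rewrite /a ival1 max_r; lra.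
Qed.

Lemma concat_cst_r (X : topologicalType) (f : I -> X) :
  continuous f -> path_homotopic (concat f (cst (f one))) f.
Proof.
move=> cf; pose a (t : I) : R := Num.min 1 (2 * ival t + 0).
have -> : concat f (cst (f one)) = extend f \o a.
  apply/funext => t; rewrite /concat /= /concat_line /a addr0.
  case: ifPn => t2; first by rewrite min_r //; lra.
  by rewrite min_l ?[RHS]extend_ge1 //; lra.
rewrite [X in path_homotopic _ X](_ : f = extend f \o @ival R); last first.
  by apply/funext => t; rewrite /= extend_ival.
apply: path_homotopic_line.
- exact: continuous_extend.
- by apply: continuous_minT; [exact: continuous_cstT|exact: continuous_affine_ival].
- exact: continuous_ival.
- by rewrite /a ival0 min_r; lra.
- by rewrite /a ival1 min_l; lra.
Qed.

Lemma concat_reverse_r (X : topologicalType) (f : I -> X) :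
  continuous f -> path_homotopic (concat f (reverse f)) (cst (f zero)).
Proof.
move=> cf; pose a (t : I) : R := Num.min (2 * ival t + 0) ((-2) * ival t + 2).
have -> : concat f (reverse f) = extend f \o a.
  apply/funext => t; have /andP[t0 t1] := ival_itv t.
  rewrite /concat /= /concat_line /a addr0.
  case: ifPn => t2; first by rewrite min_l //; lra.
  rewrite min_r; last by lra.
  rewrite /extend /reverse clampK; last by lra.
  by congr (f (clamp _)); lra.
rewrite [X in path_homotopic _ X](_ : _ = extend f \o cst 0) //.
apply: path_homotopic_line.
- exact: continuous_extend.
- apply: continuous_minT; exact: continuous_affine_ival.
- exact: continuous_cstT.
- by rewrite /a /cst ival0 min_l; lra.
- by rewrite /a /cst ival1 min_r; lra.
Qed.

Lemma reverseK (X : topologicalType) (f : I -> X) : reverse (reverse f) = f.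
Proof.
apply/funext => t; have /andP[t0 t1] := ival_itv t.
by rewrite /reverse clampK ?subKr ?ivalK //; lra.
Qed.

Lemma concat_reverse_l (X : topologicalType) (f : I -> X) :
  continuous f -> path_homotopic (concat (reverse f) f) (cst (f one)).
Proof.
move=> cf; rewrite -{2}(reverseK f) -reverse0.
exact/concat_reverse_r/continuous_reverse.
Qed.

End Homotopy.

Section FundamentalGroup.
Context (R : realType).
Local Notation I := (unit_interval R).

Definition loop (X : topologicalType) (x : X) : Type := {path I from x to x}.

HB.instance Definition _ (X : topologicalType) (x : X) := Choice.on (loop x).

Section Group.
Context (X : topologicalType) (x : X).
Implicit Types a b c : loop x.

Definition loop_homotopic a b : bool := `[< path_homotopic a b >].

Lemma loop_homotopic_refl : reflexive loop_homotopic.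
Proof. by move=> a; apply/asboolP/path_homotopic_refl/cts_fun. Qed.

Lemma loop_homotopic_sym : symmetric loop_homotopic.
Proof.
by move=> a b; apply/idP/idP => /asboolP/path_homotopic_sym ?; exact/asboolP.
Qed.

Lemma loop_homotopic_trans : transitive loop_homotopic.
Proof.
move=> b a c /asboolP ab /asboolP bc; apply/asboolP.
exact: path_homotopic_trans ab bc.
Qed.

Canonical loop_homotopic_equiv :=
  EquivRel loop_homotopic loop_homotopic_refl loop_homotopic_sym
    loop_homotopic_trans.

Definition pi1 : Type := {eq_quot loop_homotopic}.

HB.instance Definition _ := Choice.on pi1.

Definition pi1_class a : pi1 := \pi_{eq_quot loop_homotopic} a.

Lemma pi1_classP a b : pi1_class a = pi1_class b <-> path_homotopic a b.
Proof.
split=> [/eqmodP/asboolP //|ab]; apply/eqmodP; exact/asboolP.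
Qed.

Lemma pi1_repr (u : pi1) : exists a, u = pi1_class a.
Proof. by exists (repr u); rewrite /pi1_class reprK. Qed.

Lemma path_ends a b : a one = b zero :> X.
Proof. by rewrite path_one path_zero. Qed.

Lemma loop_concat0 a b : concat a b zero = x.
Proof. by rewrite concat0 path_zero. Qed.

Lemma loop_concat1 a b : concat a b one = x.
Proof. by rewrite concat1 path_one. Qed.

Lemma loop_reverse0 a : reverse a zero = x.
Proof. by rewrite reverse0 path_one. Qed.

Lemma loop_reverse1 a : reverse a one = x.
Proof. by rewrite reverse1 path_zero. Qed.

Definition loop_concat a b : loop x :=
  mk_path (continuous_concat (@cts_fun _ _ a) (@cts_fun _ _ b) (path_ends a b))
    (loop_concat0 a b) (loop_concat1 a b).

Definition loop_reverse a : loop x :=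
  mk_path (continuous_reverse (@cts_fun _ _ a)) (loop_reverse0 a) (loop_reverse1 a).

Definition loop_cst : loop x :=
  mk_path (@continuous_cstT I X x) (erefl x) (erefl x).

Definition pi1_mul (u v : pi1) : pi1 := pi1_class (loop_concat (repr u) (repr v)).
Definition pi1_inv (u : pi1) : pi1 := pi1_class (loop_reverse (repr u)).
Definition pi1_one : pi1 := pi1_class loop_cst.

Lemma repr_pi1_class a : path_homotopic (repr (pi1_class a)) a.
Proof. by apply/pi1_classP; rewrite /pi1_class reprK. Qed.

Lemma pi1_mulE a b :
  pi1_mul (pi1_class a) (pi1_class b) = pi1_class (loop_concat a b).
Proof.
apply/pi1_classP/path_homotopic_concat; first exact: path_ends.
- exact: repr_pi1_class.
- exact: repr_pi1_class.
Qed.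

Lemma pi1_invE a : pi1_inv (pi1_class a) = pi1_class (loop_reverse a).
Proof. exact/pi1_classP/path_homotopic_reverse/repr_pi1_class. Qed.

Lemma pi1_mulA : associative pi1_mul.
Proof.
move=> u v w; have [a ->] := pi1_repr u; have [b ->] := pi1_repr v.
have [c ->] := pi1_repr w; rewrite !pi1_mulE; apply/pi1_classP.
by apply: concatA; [exact: cts_fun..|exact: path_ends|exact: path_ends].
Qed.

Lemma pi1_mul1 : left_id pi1_one pi1_mul.
Proof.
move=> u; have [a ->] := pi1_repr u; rewrite pi1_mulE; apply/pi1_classP.
by have := @concat_cst_l R X a (@cts_fun _ _ a); rewrite path_zero.
Qed.

Lemma pi1_mulr1 : right_id pi1_one pi1_mul.
Proof.
move=> u; have [a ->] := pi1_repr u; rewrite pi1_mulE; apply/pi1_classP.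
by have := @concat_cst_r R X a (@cts_fun _ _ a); rewrite path_one.
Qed.

Lemma pi1_mulV : left_inverse pi1_one pi1_inv pi1_mul.
Proof.
move=> u; have [a ->] := pi1_repr u; rewrite pi1_invE pi1_mulE.
apply/pi1_classP.
by have := @concat_reverse_l R X a (@cts_fun _ _ a); rewrite path_one.
Qed.

Lemma pi1_mulrV : right_inverse pi1_one pi1_inv pi1_mul.
Proof.
move=> u; have [a ->] := pi1_repr u; rewrite pi1_invE pi1_mulE.
apply/pi1_classP.
by have := @concat_reverse_r R X a (@cts_fun _ _ a); rewrite path_zero.
Qed.

HB.instance Definition _ :=
  isGroup.Build pi1 pi1_mulA pi1_mul1 pi1_mulr1 pi1_mulV pi1_mulrV.

End Group.

Section Map.
Context (X Y : topologicalType) (x : X) (y : Y).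
Context (f : continuousType X Y) (fx : f x = y).

Lemma loop_map0 (a : loop x) : f (a zero) = y.
Proof. by rewrite path_zero. Qed.

Lemma loop_map1 (a : loop x) : f (a one) = y.
Proof. by rewrite path_one. Qed.

Definition loop_map (a : loop x) : loop y :=
  mk_path (continuous_compT (@cts_fun _ _ f) (@cts_fun _ _ a)) (loop_map0 a) (loop_map1 a).

Definition pi1_map (u : pi1 x) : pi1 y := pi1_class (loop_map (repr u)).

Lemma pi1_mapE a : pi1_map (pi1_class a) = pi1_class (loop_map a).
Proof.
apply/pi1_classP; apply: path_homotopic_comp; first exact: cts_fun.
exact: repr_pi1_class.
Qed.

Lemma pi1_mapM : {morph pi1_map : u v / (u * v)%g}.
Proof.
move=> u v; have [a ->] := pi1_repr u; have [b ->] := pi1_repr v.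
rewrite [LHS](_ : _ = pi1_map (pi1_mul (pi1_class a) (pi1_class b))) //.
rewrite [RHS](_ : _ = pi1_mul (pi1_map (pi1_class a)) (pi1_map (pi1_class b))) //.
rewrite pi1_mulE !pi1_mapE pi1_mulE; congr pi1_class; apply/path_eqP => t /=.
by rewrite /mk_path /concat /concat_line /extend; case: ifP.
Qed.

HB.instance Definition _ := isMultiplicative.Build (pi1 x) (pi1 y) pi1_map pi1_mapM.

End Map.
End FundamentalGroup.

Arguments loop R {X} x.
Arguments pi1 R {X} x.
Arguments pi1_map R {X Y x y} f fx u.

Section CW.
Context (R : realType).

Definition sqnorm (n : nat) (v : 'rV[R]_n) : R := \sum_i v ord0 i ^+ 2.
Definition closed_disc (n : nat) : set 'rV[R]_n := [set v | sqnorm v <= 1].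
Definition open_disc (n : nat) : set 'rV[R]_n := [set v | sqnorm v < 1].
Definition sphere (n : nat) : set 'rV[R]_n := [set v | sqnorm v = 1].

(* [Phi i] is the characteristic map of the [i]-th cell, of dimension [d i];
   only its values on the closed disc matter. *)
Definition finite_CW_complex (K : topologicalType) : Prop :=
  hausdorff_space K /\
  exists (N : nat) (d : 'I_N -> nat) (Phi : forall i, 'rV[R]_(d i) -> K),
    let cell i : set K := Phi i @` @open_disc (d i) in
    [/\ forall i, {within @closed_disc (d i), continuous (Phi i)},
        forall i, set_inj (@open_disc (d i)) (Phi i),
        forall z : K, exists! i, cell i z,
        forall i v, @sphere (d i) v -> exists2 j, (d j < d i)%N & cell j (Phi i v)
      & forall A : set K,
          (forall i, closed (@closed_disc (d i) `&` Phi i @^-1` A)) -> closed A].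

Definition finite_CW_type (X : topologicalType) : Prop :=
  exists2 K : topologicalType, finite_CW_complex K & homotopy_equivalent R X K.

End CW.

Section Localization.
Context (p : nat).

Definition localized_pred : {pred rat} := fun q => coprime p `|denq q|%N.

Lemma localized_predP q :
  reflect (exists b n : int, [/\ coprime p `|b|, b != 0 & q * b%:Q = n%:Q])
    (q \in localized_pred).
Proof.
apply: (iffP idP) => [pq|[b [n [pb b0 qbn]]]].
  exists (denq q), (numq q); split => //.
  by rewrite -numqE.
rewrite unfold_in; apply: coprime_dvdr pb.
rewrite -(@Gauss_dvdr _ `|numq q|); last by rewrite coprime_sym coprime_num_den.
have : numq q * b = n * denq q.
  apply/eqP; rewrite -(eqr_int rat) !rmorphM /= -qbn numqE.
  by rewrite mulrAC.
by move=> /(congr1 absz); rewrite !abszM => ->; rewrite dvdn_mull.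
Qed.

Lemma localized_subring : subring_closed localized_pred.
Proof.
split.
- by apply/localized_predP; exists 1, 1; rewrite coprimen1.
- move=> u v /localized_predP[b [n [pb b0 ubn]]].
  move=> /localized_predP[c [m [pc c0 vcm]]]; apply/localized_predP.
  exists (b * c), (n * c - m * b); split.
  + by rewrite abszM coprimeMr pb.
  + by rewrite mulf_neq0.
  + by rewrite rmorphM rmorphB !rmorphM /= -ubn -vcm; ring.
- move=> u v /localized_predP[b [n [pb b0 ubn]]].
  move=> /localized_predP[c [m [pc c0 vcm]]]; apply/localized_predP.
  exists (b * c), (n * m); split.
  + by rewrite abszM coprimeMr pb.
  + by rewrite mulf_neq0.
  + by rewrite !rmorphM /= -ubn -vcm; ring.
Qed.

HB.instance Definition _ :=
  GRing.isSubringClosed.Build rat localized_pred localized_subring.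

(* the localization of the integers at p, inside the rationals *)
Record localized_int := LocalizedInt {
  rat_of_localized :> rat; _ : rat_of_localized \in localized_pred }.

HB.instance Definition _ := [isSub for rat_of_localized].
HB.instance Definition _ := [Choice of localized_int by <:].
HB.instance Definition _ := [SubChoice_isSubComNzRing of localized_int by <:].

End Localization.

Section FreeModule.
Context (K : nzRingType) (T : choiceType) (M : lmodType K).

Lemma freegU_scale (k : K) (t : T) : << k *g t >> = k *: << t >>.
Proof. by apply/eqP/freeg_eqP => s; rewrite coeffZ !coeffU mul1r. Qed.

Lemma fgliftU (f : T -> M) (t : T) : fglift f (<< t >> : {freeg T / K}) = f t.
Proof. by rewrite liftU scale1r. Qed.

HB.instance Definition _ (f : T -> M) :=
  GRing.isZmodMorphism.Build {freeg T / K} M (fglift f) (lift_is_additive f).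

Lemma fglift_scalable (f : T -> M) : scalable (fglift f : {freeg T / K} -> M).
Proof.
move=> c z; rewrite -[z in LHS]freeg_sumE -[z in RHS]freeg_sumE scaler_sumr.
rewrite !raddf_sum; apply: eq_bigr => t _.
by rewrite freegU_scale scalerA -!freegU_scale /= !liftU scalerA.
Qed.

HB.instance Definition _ (f : T -> M) :=
  GRing.isScalable.Build K {freeg T / K} M *:%R (fglift f) (fglift_scalable f).

Lemma freeg_linear_ext (F1 F2 : {linear {freeg T / K} -> M}) :
  (forall t, F1 << t >> = F2 << t >>) -> F1 =1 F2.
Proof.
move=> F12 z; rewrite -[z]freeg_sumE !raddf_sum; apply: eq_bigr => t _.
rewrite freegU_scale /=; transitivity (coeff t z *: F1 << t >>).
  exact: linearZ.
by rewrite F12; apply/esym; exact: linearZ.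
Qed.

End FreeModule.

(* homology at C of D -> C -> B, for a composite that need not be known to be 0 *)
Section Homology.
Context (D C B : zmodType) (d : {additive D -> C}) (d' : {additive C -> B}).

Definition cycle_pred : {pred C} := fun z => d' z == 0.

Lemma cycle_pred_zmod : zmod_closed cycle_pred.
Proof.
by split=> [|u v]; rewrite !unfold_in ?raddf0 // raddfB => /eqP-> /eqP->; rewrite subr0.
Qed.

HB.instance Definition _ := GRing.isZmodClosed.Build C cycle_pred cycle_pred_zmod.

Record cycle := Cycle { chain_of_cycle : C; _ : chain_of_cycle \in cycle_pred }.

HB.instance Definition _ := [isSub for chain_of_cycle].
HB.instance Definition _ := [Choice of cycle by <:].
HB.instance Definition _ := [SubChoice_isSubZmodule of cycle by <:].

Lemma chain_of_cycleB : {morph chain_of_cycle : u v / u - v}.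
Proof. by []. Qed.

Definition boundary_pred : {pred cycle} :=
  fun z => `[< exists b, d b = chain_of_cycle z >].

Lemma boundary_pred_zmod : zmod_closed boundary_pred.
Proof.
split=> [|u v]; first by apply/asboolP; exists 0; rewrite raddf0.
move=> /asboolP[a ua] /asboolP[b vb]; apply/asboolP; exists (a - b).
by rewrite !raddfB ua vb.
Qed.

HB.instance Definition _ :=
  GRing.isZmodClosed.Build cycle boundary_pred boundary_pred_zmod.

Definition homology : zmodType := Quotient.quot boundary_pred.

Definition homology_class (z : cycle) : homology :=
  \pi_(Quotient.quot boundary_pred) z.

Lemma homology_classP (u v : cycle) :
  homology_class u = homology_class v <-> exists b, d b = chain_of_cycle u - chain_of_cycle v.
Proof.
rewrite /homology_class; split=> [/eqP|uv].
  by rewrite -Quotient.idealrBE => /asboolP[b db]; exists b; rewrite db chain_of_cycleB.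
apply/eqP; rewrite -Quotient.idealrBE; apply/asboolP.
by have [b db] := uv; exists b; rewrite db chain_of_cycleB.
Qed.

End Homology.

Section HomologyMap.
Context (D C B D' C' B' : zmodType).
Context (d : {additive D -> C}) (d' : {additive C -> B}).
Context (e : {additive D' -> C'}) (e' : {additive C' -> B'}).
Context (phi : {additive C -> C'}) (phi0 : {additive B -> B'}).
Hypothesis phi_chain : forall z, e' (phi z) = phi0 (d' z).

Lemma cycle_map_subproof (z : cycle d') : phi (chain_of_cycle z) \in cycle_pred e'.
Proof.
by case: z => z zd; rewrite unfold_in /= phi_chain (eqP zd) raddf0.
Qed.

Definition cycle_map (z : cycle d') : cycle e' := Cycle (cycle_map_subproof z).

Definition homology_map (u : homology d d') : homology e e' :=
  homology_class e (cycle_map (repr u)).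

Lemma homology_mapE (phi1 : {additive D -> D'}) (z : cycle d') :
  (forall b, e (phi1 b) = phi (d b)) ->
  homology_map (homology_class d z) = homology_class e (cycle_map z).
Proof.
move=> phi1_chain; apply/homology_classP.
have [b db] : exists b, 
      d b = chain_of_cycle (repr (homology_class d z)) - chain_of_cycle z.
  by apply/homology_classP; rewrite /homology_class reprK.
by exists (phi1 b); rewrite phi1_chain db /= raddfB.
Qed.

End HomologyMap.

Arguments homology_map {D C B D' C' B'} d {d'} e {e' phi phi0} phi_chain u.

(* The bar complex C_3 -> C_2 -> C_1 -> C_0 with trivial coefficients, with
   (g, h) standing for [g | h] *)
Section BarComplex.
Context (K : comNzRingType).

Section Differentials.
Context (G : groupType).

Definition bar_d1 : {linear {freeg G / K} -> {freeg unit / K}} :=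
  fglift (fun _ : G => << tt >> - << tt >> : {freeg unit / K}).

Definition bar_d2 : {linear {freeg (G * G) / K} -> {freeg G / K}} :=
  fglift (fun t : G * G =>
    let: (g, h) := t in << h >> - << (g * h)%g >> + << g >> : {freeg G / K}).

Definition bar_d3 : {linear {freeg (G * G * G) / K} -> {freeg (G * G) / K}} :=
  fglift (fun t : G * G * G => let: (g, h, k) := t in
    << (h, k) >> - << ((g * h)%g, k) >> + << (g, (h * k)%g) >> - << (g, h) >>
      : {freeg (G * G) / K}).

Definition group_H1 : zmodType := homology bar_d2 bar_d1.
Definition group_H2 : zmodType := homology bar_d3 bar_d2.

End Differentials.

Section Induced.
Context (G G' : groupType) (f : {multiplicative G -> G'}).

Definition bar_map (S T : choiceType) (m : S -> T) :
    {linear {freeg S / K} -> {freeg T / K}} :=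
  fglift (fun s => << m s >> : {freeg T / K}).

Lemma bar_mapU (S T : choiceType) (m : S -> T) s :
  bar_map m << s >> = << m s >>.
Proof. exact: fgliftU. Qed.

Let f1 : G -> G' := f.
Let f2 (t : G * G) : G' * G' := (f t.1, f t.2).
Let f3 (t : G * G * G) : G' * G' * G' := (f t.1.1, f t.1.2, f t.2).

Lemma bar_map1 z : bar_d1 G' (bar_map f1 z) = bar_map id (bar_d1 G z).
Proof.
pose F1 : {linear {freeg G / K} -> {freeg unit / K}} := bar_d1 G' \o bar_map f1.
pose F2 : {linear {freeg G / K} -> {freeg unit / K}} := bar_map id \o bar_d1 G.
apply: (freeg_linear_ext (F1 := F1) (F2 := F2)) => g; rewrite /F1 /F2 /=.
by rewrite !fgliftU raddfB /= !fgliftU.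
Qed.

Lemma bar_map2 z : bar_d2 G' (bar_map f2 z) = bar_map f1 (bar_d2 G z).
Proof.
pose F1 : {linear {freeg (G * G) / K} -> {freeg G' / K}} := bar_d2 G' \o bar_map f2.
pose F2 : {linear {freeg (G * G) / K} -> {freeg G' / K}} := bar_map f1 \o bar_d2 G.
apply: (freeg_linear_ext (F1 := F1) (F2 := F2)) => -[g h]; rewrite /F1 /F2 /=.
by rewrite !fgliftU raddfD raddfB /= !fgliftU /f1 gmulfM.
Qed.

Lemma bar_map3 z : bar_d3 G' (bar_map f3 z) = bar_map f2 (bar_d3 G z).
Proof.
pose F1 : {linear {freeg (G * G * G) / K} -> {freeg (G' * G') / K}} :=
  bar_d3 G' \o bar_map f3.
pose F2 : {linear {freeg (G * G * G) / K} -> {freeg (G' * G') / K}} :=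
  bar_map f2 \o bar_d3 G.
apply: (freeg_linear_ext (F1 := F1) (F2 := F2)) => -[[g h] k]; rewrite /F1 /F2 /=.
by rewrite !fgliftU raddfB raddfD raddfB /= !fgliftU /f2 /= !gmulfM.
Qed.

Definition group_H1_map : group_H1 G -> group_H1 G' :=
  homology_map (bar_d2 G) (bar_d2 G') bar_map1.

Definition group_H2_map : group_H2 G -> group_H2 G' :=
  homology_map (bar_d3 G) (bar_d3 G') bar_map2.

End Induced.
End BarComplex.

Arguments group_H1_map K {G G'} f u.
Arguments group_H2_map K {G G'} f u.

Definition surjective_fun (S T : Type) (f : S -> T) : Prop :=
  forall t, exists s, f s = t.

Definition hom_pullback (G H A : groupType) (f : {multiplicative G -> H})
    (phi : {multiplicative H -> A}) : {multiplicative G -> A} := phi \o f.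

Section Presentations.
Context (n : nat).

(* a word in the generators and their inverses; [(i, true)] is the inverse of
   the i-th generator *)
Definition word := seq ('I_n * bool).

Definition word_eval (G : groupType) (g : 'I_n -> G) (w : word) : G :=
  foldr (fun l x => ((if l.2 then (g l.1)^-1 else g l.1) * x)%g) 1%g w.

(* equality in the group presented by the relators [rels] *)
Inductive presented_eq (rels : seq word) : word -> word -> Prop :=
| PresRefl w : presented_eq rels w w
| PresSym v w : presented_eq rels v w -> presented_eq rels w v
| PresTrans u v w :
    presented_eq rels u v -> presented_eq rels v w -> presented_eq rels u w
| PresCat v v' w w' : presented_eq rels v v' -> presented_eq rels w w' ->
    presented_eq rels (v ++ w) (v' ++ w')
| PresCancel i b : presented_eq rels [:: (i, b); (i, ~~ b)] [::]
| PresRel r : r \in rels -> presented_eq rels r [::].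

End Presentations.

Definition finitely_presented (G : groupType) : Prop :=
  exists (n : nat) (g : 'I_n -> G) (rels : seq (word n)),
    surjective_fun (word_eval g) /\
    forall v w, word_eval g v = word_eval g w <-> presented_eq rels v w.

Section AlgebraicClosure.
Context (p : nat).

Definition two_connected (G H : groupType) (f : {multiplicative G -> H}) : Prop :=
  bijective (group_H1_map (localized_int p) f) /\
  surjective_fun (group_H2_map (localized_int p) f).

Definition algebraically_closed (A : groupType) : Prop :=
  forall (P G : groupType) (f : {multiplicative P -> G}),
    finitely_presented P -> finitely_presented G -> two_connected f ->
    bijective (@hom_pullback P G A f).

Definition algebraic_closure (G Ghat : groupType)
    (i : {multiplicative G -> Ghat}) : Prop :=
  algebraically_closed Ghat /\
  forall (A : groupType), algebraically_closed A ->
  forall h : {multiplicative G -> A},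
    exists! k : {multiplicative Ghat -> A}, forall x, k (i x) = h x.

End AlgebraicClosure.

Definition covering_map (E X : topologicalType) (q : E -> X) : Prop :=
  continuous q /\
  forall x : X, exists U : set X, [/\ open U, U x
    & exists V : set (set E),
      [/\ forall W, V W -> open W, trivIset V id,
          \bigcup_(W in V) W = q @^-1` U
        & forall W, V W -> set_bij W U q /\
            forall O, open O -> O `<=` W -> open (q @` O)]].

Section Towers.
Context (R : realType) (p : nat).

Definition abelian_p_group (G : finGroupType) : bool :=
  abelian [set: G]%SET && (p.-group [set: G]%SET)%g.

(* The regular cover determined by phi is the connected one whose fundamental
   group is the kernel of phi; the kernel being normal, e may be any point of
   the fibre over x. *)
Definition cover_of (X : topologicalType) (x : X) (G : groupType)
    (phi : {multiplicative pi1 R x -> G})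
    (E : topologicalType) (e : E) (q : continuousType E X) (qe : q e = x) : Prop :=
  [/\ covering_map q, connected [set: E]
    & forall u : pi1 R x, phi u = 1%g <-> exists v : pi1 R e, pi1_map R q qe v = u].

(* The condition on f_0, ..., f_n, for towers of height n. No base point of the
   covers is preferred: x1 is any point over x, and f1 is any lift of f, based at
   y1 := f1 x1. *)
Fixpoint p_tower_map_upto (n : nat) (X Y : topologicalType) (x : X) (y : Y)
    (f : continuousType X Y) (fx : f x = y) : Prop :=
  (forall G : finGroupType, abelian_p_group G ->
     bijective (@hom_pullback (pi1 R x) (pi1 R y) G (pi1_map R f fx))) /\
  if n is m.+1 then
    forall (G : finGroupType) (phi : {multiplicative pi1 R y -> G}),
      abelian_p_group G -> surjective_fun phi ->
    forall (Y1 : topologicalType) (y1 : Y1) (q : continuousType Y1 Y)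
      (qy : q y1 = y), cover_of phi qy ->
    forall (X1 : topologicalType) (x1 : X1) (r : continuousType X1 X)
      (rx : r x1 = x), cover_of (hom_pullback (pi1_map R f fx) phi) rx ->
    forall (f1 : continuousType X1 Y1) (f1x : f1 x1 = y1),
      (forall z, q (f1 z) = f (r z)) -> p_tower_map_upto m f1x
  else True.

Definition p_tower_map (X Y : topologicalType) (x : X)
    (f : continuousType X Y) : Prop :=
  forall n, p_tower_map_upto n (erefl (f x)).

End Towers.

(* Main.v *)
(* By the universal property of the algebraic closures, f induces a bijection on
   homomorphisms into every algebraically closed group, and finite p-groups are
   algebraically closed: by induction along central extensions by Z/p, lifting
   along a 2-connected map G -> H is a statement about H^1 and H^2 with Z/p
   coefficients relative to G. Hence f is a bijection on homomorphisms into all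
   finite p-groups, i.e. an isomorphism on pro-p completions. This property passes
   to the kernels of corresponding surjections onto an abelian p-group, because
   homomorphisms on such a kernel are seen by wreath products, which are again finite
   p-groups. A covering map is injective on fundamental groups, so these kernels are
   the fundamental groups of the covers, and one climbs the tower. *)
Require Import Defs.
From HB Require Import structures.
From mathcomp Require Import all_boot all_order all_algebra all_fingroup.
From mathcomp Require Import all_solvable.
From mathcomp Require Import all_classical all_reals topology.
From mathcomp Require Import normedtype continuous_path interval_inference.
From mathcomp Require Import ring lra.
From mathcomp.multinomials Require Import freeg.

Set Implicit Arguments.
Unset Strict Implicit.
Unset Printing Implicit Defensive.

Import Order.TTheory GRing.Theory Num.Theory.
Import numFieldNormedType.Exports.

Local Open Scope ring_scope.

(** * Finite p-groups are algebraically closed *)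

Lemma bijective_injsurj (S T : Type) (f : S -> T) :
  injective f -> surjective_fun f -> bijective f.
Proof.
move=> f_inj f_surj; have [g fg] := choice f_surj.
by exists g => // s; apply: f_inj.
Qed.

Lemma bijective_surjective (S T : Type) (f : S -> T) :
  bijective f -> surjective_fun f.
Proof. by move=> [g _ fg] t; exists (g t). Qed.

Lemma multiplicative_ext (G H : groupType) (u v : {multiplicative G -> H}) :
  u =1 v -> u = v.
Proof.
case: u v => [u [[uM]]] [v [[vM]]] /= /funext uv; case: _ / uv vM => vM.
by rewrite (Prop_irrelevance uM vM).
Qed.

Lemma homology_classK (D C B : zmodType) (d : {additive D -> C})
    (d' : {additive C -> B}) (u : homology d d') :
  exists z, u = homology_class d z.
Proof.
by exists (generic_quotient.repr u); rewrite /homology_class generic_quotient.reprK.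
Qed.

Definition mk_hom (G H : groupType) (u : G -> H)
    (uM : {morph u : x y / (x * y)%g}) : {multiplicative G -> H} :=
  HB.pack_for {multiplicative G -> H} u (isMultiplicative.Build G H u uM).

Lemma hom1 (G H : groupType) (f : {multiplicative G -> H}) : f 1%g = 1%g.
Proof. by apply: (mulgI (f 1%g)); rewrite -gmulfM !mulg1. Qed.

Lemma homV (G H : groupType) (f : {multiplicative G -> H}) x : f x^-1%g = (f x)^-1%g.
Proof. by apply: (mulgI (f x)); rewrite -gmulfM !mulgV hom1. Qed.

Lemma hom_pullback_eq (G H A : groupType) (f : {multiplicative G -> H})
    (u v : {multiplicative H -> A}) :
  hom_pullback f u = hom_pullback f v <-> forall x, u (f x) = v (f x).
Proof.
split=> [uv x|uv]; last exact: multiplicative_ext.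
exact: (congr1 (fun w : {multiplicative G -> A} => w x) uv).
Qed.

(** The first hypothesis makes [D] a quotient of the direct sum of [C1] and [C2]; the second says
    that [(v1, v2)] kills the kernel. Hence [w] may be computed from any chosen decomposition. *)
Lemma additive_extension (C1 C2 D M : zmodType)
    (u1 : {additive C1 -> D}) (u2 : {additive C2 -> D})
    (v1 : {additive C1 -> M}) (v2 : {additive C2 -> M}) :
  (forall z, exists x y, z = u1 x + u2 y) ->
  (forall x y, u1 x + u2 y = 0 -> v1 x + v2 y = 0) ->
  exists w : {additive D -> M},
    (forall x, w (u1 x) = v1 x) /\ (forall y, w (u2 y) = v2 y).
Proof.
move=> u_surj uv0.
have uv x y x' y' : u1 x + u2 y = u1 x' + u2 y' -> v1 x + v2 y = v1 x' + v2 y'.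
  move=> /eqP; rewrite -subr_eq0 opprD addrACA -!raddfB => /eqP/uv0/eqP.
  by rewrite !raddfB addrACA -opprD subr_eq0 => /eqP.
have /choice[dec decE] : forall z, exists d : C1 * C2, z = u1 d.1 + u2 d.2.
  by move=> z; have [x [y zE]] := u_surj z; exists (x, y).
pose w z := v1 (dec z).1 + v2 (dec z).2.
have wE x y : w (u1 x + u2 y) = v1 x + v2 y by apply: uv; rewrite -decE.
have wB : {morph w : z z' / z - z'}.
  move=> z z'; rewrite {1}(decE z) {1}(decE z') opprD addrACA -!raddfB wE.
  by rewrite !raddfB addrACA -opprD.
pose wA := GRing.isZmodMorphism.Build _ _ w wB.
exists (HB.pack_for {additive D -> M} w wA); split=> [x|y] /=.
- by have := wE x 0; rewrite !raddf0 !addr0.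
- by have := wE 0 y; rewrite !raddf0 !add0r.
Qed.

(** * Group cohomology relative to a 2-connected homomorphism *)

Section RelativeCocycle.
Context (K : comNzRingType) (M : lmodType K) (G H : groupType).
Context (f : {multiplicative G -> H}).
Hypothesis f_H1 : bijective (group_H1_map K f).
Hypothesis f_H2 : surjective_fun (group_H2_map K f).

Let f2 (t : G * G) : H * H := (f t.1, f t.2).

Lemma bar_d1_0 (L : groupType) (z : {freeg L / K}) : bar_d1 K L z = 0.
Proof.
pose F2 : {linear {freeg L / K} -> {freeg unit / K}} := \0.
by apply: (freeg_linear_ext (F1 := bar_d1 K L) (F2 := F2)) => g; rewrite /= fgliftU subrr.
Qed.

Definition cycle1 (L : groupType) (z : {freeg L / K}) :
    Defs.cycle (bar_d1 K L) :=
  @Cycle _ _ (bar_d1 K L) z (introT eqP (bar_d1_0 z)).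

Lemma group_H1_mapE (z : Defs.cycle (bar_d1 K G)) :
  group_H1_map K f (homology_class _ z) =
  homology_class _ (Defs.cycle_map (bar_map1 f) z).
Proof.
apply: (@homology_mapE _ _ _ _ _ _ _ _ _ _ _ _ (bar_map1 f) (bar_map K f2)).
exact: (bar_map2 f).
Qed.

Lemma group_H2_mapE (z : Defs.cycle (bar_d2 K G)) :
  group_H2_map K f (homology_class _ z) =
  homology_class _ (Defs.cycle_map (bar_map2 f) z).
Proof.
apply: (@homology_mapE _ _ _ _ _ _ _ _ _ _ _ _ (bar_map2 f)
  (bar_map K (fun t : G * G * G => (f t.1.1, f t.1.2, f t.2)))).
exact: (bar_map3 f).
Qed.

(** Injectivity on [H_1] in chain form, with a sum in the hypothesis to match the kernel relation of
    [additive_extension]. *)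
Lemma group_H1_inj (z : {freeg G / K}) y :
  bar_map K f z + bar_d2 K H y = 0 -> exists w, z = bar_d2 K G w.
Proof.
move=> fz; suff : homology_class (bar_d2 K G) (cycle1 z) = homology_class _ (cycle1 0).
  by move=> /homology_classP[w /= wz]; exists w; rewrite wz subr0.
apply: (bij_inj f_H1); rewrite !group_H1_mapE; apply/homology_classP.
exists (- y); rewrite raddfN /= raddf0 subr0.
by apply/esym/eqP; rewrite -addr_eq0; apply/eqP.
Qed.

Lemma group_H1_surj (z : {freeg H / K}) :
  exists x y, z = bar_map K f x + bar_d2 K H y.
Proof.
have [u fu] := bijective_surjective f_H1 (homology_class _ (cycle1 z)).
have [x uE] := homology_classK u.
move: fu; rewrite uE group_H1_mapE => /esym/homology_classP[y /= yE].
by exists (chain_of_cycle x), y; rewrite yE addrC subrK.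
Qed.

Lemma group_H2_surj (z : {freeg (H * H) / K}) : bar_d2 K H z = 0 ->
  exists x w, bar_d2 K G x = 0 /\ z = bar_map K f2 x + bar_d3 K H w.
Proof.
move=> z0; pose zc := @Cycle _ _ (bar_d2 K H) z (introT eqP z0).
have [u fu] := f_H2 (homology_class _ zc).
have [[x x0] uE] := homology_classK u.
move: fu; rewrite uE group_H2_mapE => /esym/homology_classP[w /= wE].
by exists x, w; split; [exact/eqP|rewrite wE addrC subrK].
Qed.

(* H^2 of the mapping cone of f vanishes: every 1-chain of H is f x + d y for
   some chain x of G and some 2-chain y of H, and f x + d y |-> b x + c y is well
   defined. *)
Lemma relative_coboundary (b : G -> M) (c : H * H -> M) :
  (forall g h k, c (h, k) - c ((g * h)%g, k) + c (g, (h * k)%g) - c (g, h) = 0) ->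
  (forall x y, c (f x, f y) = b y - b (x * y)%g + b x) ->
  exists beta : H -> M, (forall x, beta (f x) = b x) /\
    forall g h, c (g, h) = beta h - beta (g * h)%g + beta g.
Proof.
move=> c_cocycle c_b.
pose bl : {linear {freeg G / K} -> M} := fglift b.
pose cl : {linear {freeg (H * H) / K} -> M} := fglift c.
have cl_d3 w : cl (bar_d3 K H w) = 0.
  pose F1 : {linear {freeg (H * H * H) / K} -> M} := cl \o bar_d3 K H.
  pose F2 : {linear {freeg (H * H * H) / K} -> M} := \0.
  apply: (freeg_linear_ext (F1 := F1) (F2 := F2)) => -[[g h] k]; rewrite /F1 /F2 /=.
  by rewrite !fgliftU raddfB raddfD raddfB /= !fgliftU.
have cl_f x : cl (bar_map K f2 x) = bl (bar_d2 K G x).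
  pose F1 : {linear {freeg (G * G) / K} -> M} := cl \o bar_map K f2.
  pose F2 : {linear {freeg (G * G) / K} -> M} := bl \o bar_d2 K G.
  apply: (freeg_linear_ext (F1 := F1) (F2 := F2)) => -[g h]; rewrite /F1 /F2 /=.
  by rewrite !fgliftU raddfD raddfB /= !fgliftU c_b.
have wd x y : bar_map K f x + bar_d2 K H y = 0 -> bl x + cl y = 0.
  (* As [x] is the boundary of [w], the chain [f2 w + y] is a 2-cycle. Surjectivity on [H_2]
     replaces it, up to a boundary, by the image of a cycle [x'] of [G], on which [cl] takes the
     value [bl (d x') = 0]. *)
  move=> fxy; have [w xw] := group_H1_inj fxy.
  have /group_H2_surj[x' [w' [dx' wyE]]] : bar_d2 K H (bar_map K f2 w + y) = 0.
    by rewrite -fxy xw -(bar_map2 f) -raddfD.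
  by rewrite xw -cl_f -raddfD wyE raddfD [X in _ + X]cl_d3 addr0 [LHS]cl_f dx' raddf0.
have [w [wf wd2]] := additive_extension group_H1_surj wd.
exists (fun h => w << h >>); split=> [x|g h].
- by rewrite -(bar_mapU K f) wf; exact: fgliftU.
- have := wd2 << (g, h) >>; rewrite -(fgliftU c (g, h)) => <-.
  by rewrite -raddfB -raddfD; congr (w _); exact: fgliftU.
Qed.

(** The linear extension of [chi] kills boundaries because [chi] is additive, and it kills the image
    of [f]. By surjectivity on [H_1] these span the 1-chains of [H]. *)
Lemma hom_to_module_eq0 (chi : H -> M) :
  {morph chi : g h / (g * h)%g >-> g + h} -> (forall x, chi (f x) = 0) ->
  forall h, chi h = 0.
Proof.
move=> chiM chi_f h.
pose chil : {linear {freeg H / K} -> M} := fglift chi.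
have chil_d2 y : chil (bar_d2 K H y) = 0.
  pose F1 : {linear {freeg (H * H) / K} -> M} := chil \o bar_d2 K H.
  pose F2 : {linear {freeg (H * H) / K} -> M} := \0.
  apply: (freeg_linear_ext (F1 := F1) (F2 := F2)) => -[g k]; rewrite /F1 /F2 /=.
  rewrite !fgliftU raddfD raddfB /= !fgliftU chiM opprD (addrC (- chi g)).
  by rewrite addrA subrr add0r addNr.
have chil_f x : chil (bar_map K f x) = 0.
  pose F1 : {linear {freeg G / K} -> M} := chil \o bar_map K f.
  pose F2 : {linear {freeg G / K} -> M} := \0.
  apply: (freeg_linear_ext (F1 := F1) (F2 := F2)) => g; rewrite /F1 /F2 /=.
  by rewrite !fgliftU.
have [x [y xyE]] := group_H1_surj << h >>.
rewrite -(fgliftU chi h : chil << h >> = _) xyE raddfD.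
by rewrite [X in X + _]chil_f [X in _ + X]chil_d2 addr0.
Qed.

End RelativeCocycle.

(* The alias carries the Z_(p)-module structure; primality enters because 'F_1 is
   the field with two elements. *)
Definition residue_field (p : nat) (p_prime : prime p) : Type := 'F_p.

(** * The field with p elements as a module over the localized integers *)

Section Residue.
Context (p : nat) (p_prime : prime p).
Local Notation K := (localized_int p).
Local Notation F := (residue_field p_prime).

HB.instance Definition _ := GRing.Field.on F.

Definition residue (q : K) : 'F_p := (numq q)%:~R / (denq q)%:~R.

Lemma coprime_intr_Fp_neq0 (b : int) : coprime p `|b| -> b%:~R != 0 :> 'F_p.
Proof.
move=> pb; have : `|b|%N%:R != 0 :> 'F_p.
  rewrite -(dvdn_pcharf (pchar_Fp p_prime)).
  by rewrite -prime_coprime.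
apply: contraNN; case: b {pb} => n //=.
by rewrite NegzE rmorphN /= oppr_eq0.
Qed.

(** Frees the residue from the reduced fraction: sums and products arise as unreduced fractions
    whose denominator is still prime to p. *)
Lemma residueE (q : K) (b n : int) :
  coprime p `|b| -> (q : rat) * b%:~R = n%:~R -> residue q * b%:~R = n%:~R.
Proof.
move=> pb qbn; rewrite /residue mulrAC; apply: (canLR (mulfK _)).
  by apply: coprime_intr_Fp_neq0; case: q {qbn}.
rewrite -!rmorphM /=; congr (_%:~R); apply/eqP.
by rewrite -(eqr_int rat) !rmorphM /= -qbn numqE mulrAC.
Qed.

Lemma residue_eq (q : K) (b n : int) :
  coprime p `|b| -> (q : rat) * b%:~R = n%:~R -> residue q = n%:~R / b%:~R.
Proof.
by move=> pb /(residueE pb) <-; rewrite mulfK // coprime_intr_Fp_neq0.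
Qed.

Lemma residue_frac (q : K) : exists b n : int,
  [/\ coprime p `|b|, (q : rat) * b%:~R = n%:~R & residue q = n%:~R / b%:~R].
Proof. by exists (denq q), (numq q); split=> //; [case: q|rewrite numqE]. Qed.

Lemma residue1 : residue 1 = 1.
Proof. by rewrite (@residue_eq _ 1 1) ?coprimen1 ?divr1. Qed.

Lemma residueM : {morph residue : q r / q * r}.
Proof.
move=> q r; have [b [n [pb qb ->]]] := residue_frac q.
have [c [m [pc rc ->]]] := residue_frac r.
rewrite (@residue_eq _ (b * c) (n * m)) ?abszM ?coprimeMr ?pb //.
  by rewrite !rmorphM /= invfM mulrACA.
have -> : (q * r)%R = (q : rat) * (r : rat) :> rat by [].
by rewrite !rmorphM /= -qb -rc; ring.
Qed.

Lemma residueD : {morph residue : q r / q + r}.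
Proof.
move=> q r; have [b [n [pb qb ->]]] := residue_frac q.
have [c [m [pc rc ->]]] := residue_frac r.
rewrite (@residue_eq _ (b * c) (n * c + m * b)) ?abszM ?coprimeMr ?pb //.
  rewrite !(rmorphM, rmorphD) /=.
  by field; rewrite !coprime_intr_Fp_neq0.
have -> : (q + r)%R = (q : rat) + (r : rat) :> rat by [].
by rewrite !(rmorphM, rmorphD) /= -qb -rc; ring.
Qed.

Definition residue_scale (q : K) (i : F) : F := residue q * (i : 'F_p).

Lemma residue_scaleA q r i :
  residue_scale q (residue_scale r i) = residue_scale (q * r) i.
Proof. by rewrite /residue_scale residueM mulrA. Qed.

Lemma residue_scale1 : left_id 1 residue_scale.
Proof. by move=> i; rewrite /residue_scale residue1 mul1r. Qed.

Lemma residue_scaleDr : right_distributive residue_scale +%R.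
Proof. by move=> q i j; exact: mulrDr. Qed.

Lemma residue_scaleDl i : {morph residue_scale^~ i : q r / q + r}.
Proof. by move=> q r; rewrite /residue_scale residueD mulrDl. Qed.

HB.instance Definition _ := GRing.Zmodule_isLmodule.Build K F
  residue_scaleA residue_scale1 residue_scaleDr residue_scaleDl.

End Residue.

(** * Lifting homomorphisms through a central extension by Z/p *)

Section CentralExtension.
Local Open Scope group_scope.
Context (p : nat) (p_prime : prime p) (G H : groupType).
Context (f : {multiplicative G -> H}) (f_2conn : two_connected p f).
Context (P : finGroupType) (z : P).
Hypotheses (z_center : z \in 'Z([set: P])) (z_order : #[z]%g = p).

Local Notation F := (residue_field p_prime).
Local Notation Q := (coset_of <[z]>).

(** Identifies the additive group [F] with the central subgroup generated by [z], so that elements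
    of one coset differ by a scalar. *)
Let expz (i : F) : P := z ^+ (i : 'F_p).

Let expzD (i j : F) : expz (i + j)%R = expz i * expz j.
Proof.
have zp : z ^+ p = 1 by rewrite -z_order expg_order.
rewrite /expz -expgnDr -[RHS](expg_mod _ zp); congr (_ ^+ _).
exact: (congr1 (modn (_ : nat)) (Fp_cast p_prime)).
Qed.

Let expz_comm (i : F) x : expz i * x = x * expz i.
Proof.
by have /centerP[_ /(_ x)] := groupX (i : 'F_p) z_center; apply; rewrite inE.
Qed.

Let expz_inj (i j : F) : expz i = expz j -> i = j.
Proof.
move=> /eqP; rewrite /expz eq_expg_mod_order z_order => /eqP.
have ltp (k : 'F_p) : (k < p)%N by rewrite -[X in (_ < X)%N](Fp_cast p_prime).
by rewrite !modn_small ?ltp //; exact: ord_inj.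
Qed.

Let in_norm x : x \in 'N(<[z]>).
Proof.
have /fintype.subsetP : [set: P] \subset 'N(<[z]>).
  by rewrite cents_norm // centsC cycle_subG; case/finset.setIP: z_center.
by apply; rewrite inE.
Qed.

Let coset_mul : {morph coset <[z]> : x y / x * y}.
Proof. by move=> x y; rewrite morphM. Qed.

Let coset_eq (x y : P) : coset <[z]> x = coset <[z]> y -> exists i, x = y * expz i.
Proof.
move=> /(rcoset_kercosetP (in_norm x) (in_norm y))/rcosetP[_ /cycleP[k ->] ->].
have zp : z ^+ p = 1 by rewrite -z_order expg_order.
have zk : z ^+ k = expz (k%:R%R : 'F_p) by rewrite /expz val_Fp_nat // expg_mod.
by exists (k%:R%R : 'F_p); rewrite zk expz_comm.
Qed.

Let quo : {multiplicative P -> Q} := mk_hom coset_mul.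

(** Once the homomorphism on [G] is prescribed, the obstruction to lifting from [Q] to [P] and the
    ambiguity of a lift are relative cohomology classes with coefficients in [F], and these
    vanish. *)
Lemma central_extension_bijective :
  bijective (@hom_pullback G H Q f) -> bijective (@hom_pullback G H P f).
Proof.
move=> f_quo; apply: bijective_injsurj.
  move=> u v uv.
  have uvQ : hom_pullback u quo = hom_pullback v quo.
    apply: (bij_inj f_quo); apply: multiplicative_ext => x /=.
    have := congr1 (fun w : {multiplicative G -> P} => w x) uv.
    by move=> /= ->.
  (* Two lifts of the same map to [Q] differ by [chi]; centrality of [z] makes it a homomorphism,
     and it vanishes on the image of [f]. *)
  have /choice[chi chiE] : forall h, exists i, u h = v h * expz i.
    move=> h; apply: coset_eq.
    exact: (congr1 (fun w : {multiplicative H -> Q} => w h) uvQ).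
  have chiM : {morph chi : g h / g * h >-> (g + h)%R}.
    move=> g h; apply: expz_inj; apply: (mulgI (v (g * h))).
    rewrite -chiE !gmulfM !chiE expzD !mulgA; congr (_ * _).
    by rewrite -!mulgA; congr (_ * _); rewrite expz_comm.
  have chi0 : forall h, chi h = 0%R.
    apply: (hom_to_module_eq0 f_2conn.1 chiM) => x; apply: expz_inj.
    apply: (mulgI (v (f x))); rewrite -chiE.
    have := congr1 (fun w : {multiplicative G -> P} => w x) uv.
    by rewrite /= => ->; rewrite /expz /= mulg1.
  by apply: multiplicative_ext => h; rewrite chiE chi0 /expz /= mulg1.
move=> phi; have [psi psiE] := bijective_surjective f_quo (hom_pullback phi quo).
(* A set-theoretic lift of [psi]. Its failure to be multiplicative is the factor set [c], and its
   deviation from [phi] along [f] is the cochain [b], whose coboundary is the pullback of [c]. *)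
pose s (g : H) : P := repr (psi g).
have sE g : coset <[z]> (s g) = psi g by exact: coset_reprK.
have /choice[c cE] : forall t : H * H, exists i, s t.1 * s t.2 = s (t.1 * t.2) * expz i.
  by move=> t; apply: coset_eq; rewrite coset_mul !sE gmulfM.
have /choice[b bE] : forall x, exists i, s (f x) = phi x * expz i.
  move=> x; apply: coset_eq; rewrite sE.
  exact: (congr1 (fun w : {multiplicative G -> Q} => w x) psiE).
have sM g h : s g * s h = s (g * h) * expz (c (g, h)) := cE (g, h).
have c_cocycle g h k :
    (c (h, k) - c ((g * h)%g, k) + c (g, (h * k)%g) - c (g, h) = 0)%R.
  have sA1 : s g * (s h * s k) = s (g * (h * k)) * expz (c (g, (h * k)%g) + c (h, k))%R.
    by rewrite sM mulgA sM -mulgA -expzD.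
  have sA2 : s g * s h * s k = s (g * h * k) * expz (c ((g * h)%g, k) + c (g, h))%R.
    by rewrite sM -mulgA expz_comm mulgA sM -mulgA -expzD.
  have := mulgA (s g) (s h) (s k); rewrite sA1 sA2 mulgA => /mulgI/expz_inj.
  move=> cA; transitivity
      ((c (g, (h * k)%g) + c (h, k)) - (c ((g * h)%g, k) + c (g, h)))%R.
    by ring.
  by rewrite cA GRing.subrr.
have c_b x y : c (f x, f y) = (b y - b (x * y)%g + b x)%R.
  have := sM (f x) (f y); rewrite -gmulfM !bE gmulfM.
  rewrite -!mulgA => /mulgI; rewrite [LHS]mulgA expz_comm -mulgA => /mulgI.
  rewrite -!expzD => /expz_inj bD.
  by apply: (GRing.addrI (b (x * y)%g)); rewrite -bD; ring.
have [beta [beta_f c_beta]] :=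
  relative_coboundary f_2conn.1 f_2conn.2 c_cocycle c_b.
(* Correcting [s] by [beta] cancels the factor set; since [beta] restricts to [b], the corrected map
   restricts to [phi]. *)
have psiM : {morph (fun g => s g * expz (- beta g)%R) : g h / g * h}.
  move=> g h /=; rewrite mulgA -(mulgA (s g)) expz_comm mulgA sM -!mulgA -!expzD.
  congr (_ * expz _); rewrite c_beta; ring.
exists (mk_hom psiM); apply: multiplicative_ext => x /=.
by rewrite bE beta_f -mulgA -expzD GRing.addrN /expz /= mulg1.
Qed.

End CentralExtension.

(** Induction on the order: a nontrivial p-group has a nontrivial centre, which contains an element
    of order p, and the quotient by it is a smaller p-group. *)
Lemma pgroup_algebraically_closed (p : nat) (P : finGroupType) :
  prime p -> (p.-group [set: P])%g -> algebraically_closed p P.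
Proof.
move=> p_prime + G H f _ _ f_2conn; have [n] := ubnP #|P|.
elim: n P => // n IHn P Pn pP; have [P1|P_neq1] := eqVneq [set: P]%SET 1%g.
  have P_triv (x : P) : x = 1%g by apply/set1gP; rewrite -P1 inE.
  apply: bijective_injsurj => [u v _|u].
    by apply: multiplicative_ext => h; rewrite [LHS]P_triv [RHS]P_triv.
  have oneM : {morph (fun _ : H => 1%g : P) : x y / (x * y)%g}.
    by move=> x y; rewrite mulg1.
  exists (mk_hom oneM); apply: multiplicative_ext => x.
  by rewrite [LHS]P_triv [RHS]P_triv.
have ZP_neq1 : ('Z([set: P]) != 1)%g by rewrite (center_nil_eq1 (pgroup_nil pP)).
have pZ : (p.-group 'Z([set: P]))%g := pgroupS (center_sub _) pP.
have [_ p_dvd _] := pgroup_pdiv pZ ZP_neq1.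
have [z z_center z_order] := Cauchy p_prime p_dvd.
apply: (central_extension_bijective p_prime f_2conn z_center z_order).
have NT : ('N(<[z]>) = [set: P])%g.
  apply/eqP; rewrite finset.eqEsubset finset.subsetT cents_norm // centsC cycle_subG.
  by case/finset.setIP: z_center.
have PQ : ([set: P] / <[z]> = [set: coset_of (<[z]>)])%g.
  by rewrite -(im_quotient <[z]>) -NT.
apply: IHn; last by rewrite -PQ quotient_pgroup.
rewrite -ltnS; apply: leq_trans Pn; rewrite ltnS -cardsT -PQ -(cardsT P).
by rewrite ltn_quotient // ?cycle_eq1 -?order_gt1 ?z_order ?prime_gt1 // finset.subsetT.
Qed.

(** * Pro-p equivalences *)

Definition wreath (P Q : finGroupType) : Type := ({ffun Q -> P} * Q)%type.

Section Wreath.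
Local Open Scope group_scope.
Context (P Q : finGroupType).
Local Notation W := (wreath P Q).

HB.instance Definition _ := Finite.copy W ({ffun Q -> P} * Q)%type.

(** The semidirect product in which [Q] acts on functions by right translation of the argument. *)
Definition wreath_mul (u v : W) : W :=
  ([ffun x => u.1 x * v.1 (x * u.2)], u.2 * v.2).
Definition wreath_one : W := ([ffun => 1], 1).
Definition wreath_inv (u : W) : W := ([ffun x => (u.1 (x * u.2^-1))^-1], u.2^-1).

Lemma wreath_mulA : associative wreath_mul.
Proof.
move=> u v w; congr (_, _); last by rewrite mulgA.
by apply/ffunP => x; rewrite !ffunE /= !mulgA.
Qed.

Lemma wreath_mul1 : left_id wreath_one wreath_mul.
Proof.
move=> [u q]; congr (_, _); last by rewrite mul1g.
by apply/ffunP => x; rewrite !ffunE /= mul1g mulg1.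
Qed.

Lemma wreath_mulV : left_inverse wreath_one wreath_inv wreath_mul.
Proof.
move=> u; congr (_, _); last by rewrite mulVg.
by apply/ffunP => x; rewrite !ffunE /= mulVg.
Qed.

HB.instance Definition _ :=
  Finite_isGroup.Build W wreath_mulA wreath_mul1 wreath_mulV.

Lemma pgroup_wreath (p : nat) :
  p.-group [set: P] -> p.-group [set: Q] -> p.-group [set: W].
Proof.
rewrite /pgroup !cardsT => pP pQ.
by rewrite card_prod card_ffun pnatM pnatX pP pQ.
Qed.

End Wreath.

(* f is an isomorphism on pro-p completions *)
Definition pro_p_equivalence (p : nat) (G H : groupType)
    (f : {multiplicative G -> H}) : Prop :=
  forall P : finGroupType, (p.-group [set: P])%g -> bijective (@hom_pullback G H P f).

Section ProP.
Local Open Scope group_scope.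
Context (p : nat) (G H : groupType) (f : {multiplicative G -> H}).
Hypothesis f_eq : pro_p_equivalence p f.

Lemma pro_p_inj (P : finGroupType) (u v : {multiplicative H -> P}) :
  p.-group [set: P] -> (forall x, u (f x) = v (f x)) -> u =1 v.
Proof. by move=> pP /hom_pullback_eq/(bij_inj (f_eq pP)) ->. Qed.

Lemma pro_p_surj (P : finGroupType) (u : {multiplicative G -> P}) :
  p.-group [set: P] -> exists v : {multiplicative H -> P}, forall x, v (f x) = u x.
Proof.
move=> pP; have [v <-] := bijective_surjective (f_eq pP) u.
by exists v.
Qed.

(* Otherwise the quotient of the target by the image of G would be a nontrivial
   p-quotient of H that is trivial on G. *)
Lemma pro_p_surjective (Q : finGroupType) (phi : {multiplicative H -> Q}) :
  abelian_p_group p Q -> surjective_fun phi ->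
  surjective_fun (hom_pullback f phi).
Proof.
move=> /andP[Q_abelian pQ] phi_surj.
pose M := [set x : Q | `[< exists g, phi (f g) = x >]]%SET.
have M_group : group_set M.
  apply/group_setP; split=> [|x y]; rewrite !inE.
    by exists 1; rewrite !hom1.
  move=> [g <-] [h <-]; by exists (g * h); rewrite !gmulfM.
pose MG := group M_group.
have nM x : x \in 'N(MG).
  have /fintype.subsetP : [set: Q] \subset 'N(MG).
    by apply: sub_abelian_norm => //; exact: finset.subsetT.
  by apply; rewrite inE.
have cosetM : {morph (fun h => coset MG (phi h)) : x y / x * y}.
  by move=> x y /=; rewrite gmulfM morphM.
have oneM : {morph (fun _ : H => 1 : coset_of MG) : x y / x * y}.
  by move=> x y; rewrite mulg1.
have pQM : p.-group [set: coset_of MG].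
  rewrite -(im_quotient MG); apply: quotient_pgroup.
  by apply: pgroupS pQ; exact: finset.subsetT.
have quo1 : mk_hom cosetM =1 mk_hom oneM.
  apply: (pro_p_inj pQM) => g /=; apply: coset_id; rewrite !inE.
  by exists g.
move=> q; have [h <-] := phi_surj q.
have := quo1 h; rewrite /= => /(coset_idr (nM _)).
by rewrite !inE.
Qed.

Section Kernel.
Context (Q : finGroupType) (phi : {multiplicative H -> Q}).
Hypotheses (Q_p : abelian_p_group p Q) (phi_surj : surjective_fun phi).
Context (N N' : groupType) (j : {multiplicative N' -> H}) (i : {multiplicative N -> G}).
Context (f' : {multiplicative N -> N'}).
Hypotheses (i_inj : injective i) (j_inj : injective j).
Hypothesis i_ker : forall g, phi (f g) = 1 <-> exists n, i n = g.
Hypothesis j_ker : forall h, phi h = 1 <-> exists n, j n = h.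
Hypothesis f_restr : forall n, j (f' n) = f (i n).

(* A homomorphism w on the kernel of a surjection phi induces a homomorphism into
   the wreath product, g |-> (x |-> w (s x * g * (s (x * phi g))^-1), phi g), where
   s is a section of phi with s 1 = 1; its first component at 1 restricts to w. As s
   can be chosen with values in the image of G, induction commutes with f. *)
Lemma pro_p_equivalence_kernel : pro_p_equivalence p f'.
Proof.
have pQ : p.-group [set: Q] by case/andP: Q_p.
have [s0 s0E] := choice (pro_p_surjective Q_p phi_surj).
(* Normalizing at 1 yields [t (1, j n) = n] below, so that the coordinate at 1 recovers the original
   homomorphism on the kernel. *)
pose s q := if q == 1 then 1 else s0 q.
have s1 : s 1 = 1 by rewrite /s eqxx.
have sE q : phi (f (s q)) = q.
  by rewrite /s; case: eqP => [->|_]; [rewrite !hom1|exact: s0E].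
have s_ker x g : phi (f (s x * g * (s (x * phi (f g)))^-1)) = 1.
  by rewrite !gmulfM !homV !sE mulgV.
have t_ker x h : phi (f (s x) * h * (f (s (x * phi h)))^-1) = 1.
  by rewrite !gmulfM !homV !sE mulgV.
move=> P pP; have pW := pgroup_wreath pP pQ.
apply: bijective_injsurj => [u v /hom_pullback_eq uv|u].
- have /choice[t tE] : forall xh : Q * H,
      exists n, j n = f (s xh.1) * xh.2 * (f (s (xh.1 * phi xh.2)))^-1.
    by move=> xh; apply/j_ker/t_ker.
  pose ind (w : N' -> P) h : wreath P Q := ([ffun x => w (t (x, h))], phi h).
  have indM (w : {multiplicative N' -> P}) : {morph ind w : h k / h * k}.
    move=> h k; congr (_, _); last exact: gmulfM.
    (* The identity [t (x, h * k) = t (x, h) * t (x * phi h, k)] matches the multiplication of the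
       wreath product. *)
    apply/ffunP => x; rewrite !ffunE -gmulfM; congr (w _); apply: j_inj.
    by rewrite gmulfM !tE /= !gmulfM !mulgA mulgKV.
  have uv_ind : mk_hom (indM u) =1 mk_hom (indM v).
    apply: (pro_p_inj pW) => g; congr (_, _); apply/ffunP => x; rewrite !ffunE.
    have [n nE] : exists n, i n = s x * g * (s (x * phi (f g)))^-1.
      exact/i_ker/s_ker.
    (* The section takes its values in [G], so for an argument from [G] the kernel element comes
       from [N], where [u] and [v] agree. *)
    have -> : t (x, f g) = f' n.
      by apply: j_inj; rewrite tE f_restr nE !gmulfM homV.
    exact: uv.
  apply: multiplicative_ext => n.
  have := congr1 (fun w : wreath P Q => w.1 1) (uv_ind (j n)).
  rewrite /= !ffunE; have -> : t (1, j n) = n.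
    apply: j_inj; rewrite tE /= (proj2 (j_ker (j n))); last by exists n.
    by rewrite mulg1 s1 hom1 mul1g invg1 mulg1.
  by [].
- have /choice[t tE] : forall xg : Q * G,
      exists n, i n = s xg.1 * xg.2 * (s (xg.1 * phi (f xg.2)))^-1.
    by move=> xg; apply/i_ker/s_ker.
  pose ind g : wreath P Q := ([ffun x => u (t (x, g))], phi (f g)).
  have indM : {morph ind : g k / g * k}.
    move=> g k; congr (_, _); last by rewrite !gmulfM.
    apply/ffunP => x; rewrite !ffunE -gmulfM; congr (u _); apply: i_inj.
    by rewrite gmulfM !tE /= !gmulfM !mulgA mulgKV.
  have [w wE] := pro_p_surj (mk_hom indM) pW.
  have sndM : {morph (fun h => (w h).2) : h k / h * k}.
    by move=> h k /=; rewrite gmulfM.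
  (* Both maps agree on the image of [f]. Hence [w] sends the kernel into the base group of
     functions, where evaluation at 1 is multiplicative. *)
  have w2 : mk_hom sndM =1 phi by apply: (pro_p_inj pQ) => g; rewrite /= wE.
  have w2j n : (w (j n)).2 = 1 by rewrite [LHS]w2; apply/j_ker; exists n.
  have vM : {morph (fun n => (w (j n)).1 1) : n m / n * m}.
    by move=> n m; rewrite /= !gmulfM ffunE /= w2j mulg1.
  exists (mk_hom vM); apply: multiplicative_ext => n /=.
  rewrite f_restr wE /= ffunE; congr (u _); apply: i_inj; rewrite tE /=.
  rewrite (proj2 (i_ker (i n))); last by exists n.
  by rewrite mulg1 s1 mul1g invg1 mulg1.
Qed.

End Kernel.
End ProP.

(** Finite p-groups are algebraically closed, so homomorphisms into them factor uniquely through the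
    closures, where they are transported along [fhat] and its inverse. *)
Lemma pro_p_equivalence_closure (p : nat) (G H A B : groupType)
    (f : {multiplicative G -> H}) (iG : {multiplicative G -> A})
    (iH : {multiplicative H -> B}) (fhat : {multiplicative A -> B}) :
  prime p -> algebraic_closure p iG -> algebraic_closure p iH ->
  (forall x, fhat (iG x) = iH (f x)) -> bijective fhat ->
  pro_p_equivalence p f.
Proof.
move=> p_prime [_ G_univ] [_ H_univ] fhatE [fhatV fhatK fhatVK] P pP.
have P_closed := pgroup_algebraically_closed p_prime pP.
have fhatVM : {morph fhatV : x y / (x * y)%g}.
  by move=> x y; apply: (can_inj fhatK); rewrite gmulfM !fhatVK.
apply: bijective_injsurj => [u v /hom_pullback_eq uv|u].
- have [u' [u'E _]] := H_univ _ P_closed u.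
  have [v' [v'E _]] := H_univ _ P_closed v.
  have [w [_ w_uniq]] := G_univ _ P_closed (hom_pullback f u).
  have wu : w = hom_pullback fhat u'.
    by apply: w_uniq => x /=; rewrite fhatE u'E.
  have wv : w = hom_pullback fhat v'.
    by apply: w_uniq => x /=; rewrite fhatE v'E uv.
  have uv' : hom_pullback fhat u' = hom_pullback fhat v' by rewrite -wu.
  apply: multiplicative_ext => h; rewrite -u'E -v'E -(fhatVK (iH h)).
  by move/hom_pullback_eq: uv'; apply.
- have [v [vE _]] := G_univ _ P_closed u.
  exists (hom_pullback iH (hom_pullback (mk_hom fhatVM) v)).
  apply: multiplicative_ext => x /=.
  by rewrite -fhatE fhatK vE.
Qed.

(** * Covering maps and the fundamental group *)

Local Open Scope classical_set_scope.
Local Open Scope ring_scope.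

Section Lifting.
Context (R : realType) (E X : topologicalType) (q : E -> X).

Definition evenly_covered (U : set X) : Prop :=
  open U /\ exists V : set (set E),
    [/\ forall W, V W -> open W, trivIset V id,
        \bigcup_(W in V) W = q @^-1` U
      & forall W, V W -> set_bij W U q /\
          forall O, open O -> O `<=` W -> open (q @` O)].

Hypothesis q_cover : covering_map q.

Lemma evenly_covered_nbhd x : exists2 U, evenly_covered U & U x.
Proof.
by have [_ /(_ x)[U [oU Ux [V VP]]]] := q_cover; exists U => //; split=> //; exists V.
Qed.

(** The set where the lifts agree is nonempty, open because [q] is injective on each sheet, and
    closed because distinct sheets are disjoint. *)
Lemma lift_unique (T : topologicalType) (a b : T -> E) (t0 : T) :
  connected [set: T] -> continuous a -> continuous b ->
  (forall t, q (a t) = q (b t)) -> a t0 = b t0 -> a =1 b.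
Proof.
move=> T_conn ca cb qab ab0.
suff agree : [set t | a t = b t] = setT.
  by move=> t; have : [set t | a t = b t] t by rewrite agree.
have sheet t : exists V : set (set E), [/\ forall W, V W -> open W, trivIset V id,
    forall W, V W -> set_inj W q, exists2 W, V W & W (a t) & exists2 W, V W & W (b t)].
  have [U [oU [V [oV tV UV VU]]] Uat] := evenly_covered_nbhd (q (a t)).
  exists V; split=> //.
  - by move=> W /VU[[_ ? _] _].
  - have : (q @^-1` U) (a t) by [].
    by rewrite -UV.
  - have : (q @^-1` U) (b t) by rewrite /= -qab.
    by rewrite -UV.
apply: T_conn; first by exists t0.
- exists [set t | a t = b t]; last by rewrite setTI.
  rewrite openE => t abt; have [V [oV _ iV [W VW Wat] _]] := sheet t.
  have aW : \near t, W (a t) by apply: ca; apply: open_nbhs_nbhs; split=> //; exact: oV.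
  have bW : \near t, W (b t).
    by apply: cb; rewrite -abt; apply: open_nbhs_nbhs; split=> //; exact: oV.
  rewrite /interior; near=> t'.
  by apply: (iV _ VW) => //; rewrite inE; near: t'.
- exists [set t | a t = b t]; last by rewrite setTI.
  rewrite -openC openE => t abt.
  have [V [oV tV iV [W VW Wat] [W' VW' W'bt]]] := sheet t.
  have aW : \near t, W (a t) by apply: ca; apply: open_nbhs_nbhs; split=> //; exact: oV.
  have bW : \near t, W' (b t) by apply: cb; apply: open_nbhs_nbhs; split=> //; exact: oV.
  rewrite /interior; near=> t' => abt'; apply: abt.
  have WW' : W = W'.
    apply: (tV _ _ VW VW'); exists (a t'); split=> /=; first by near: t'.
    by rewrite abt'; near: t'.
  by apply: (iV _ VW); rewrite ?inE // WW'.
Unshelve. all: by end_near. Qed.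

(** The lift follows [k] by the inverse of [q] on the sheet containing [e]; this inverse is
    continuous since [q] is open on the sheet. *)
Lemma lift_evenly_covered (T : topologicalType) (U : set X) (k : T -> X)
    (t0 : T) (e : E) :
  evenly_covered U -> continuous k -> (forall t, U (k t)) -> q e = k t0 ->
  exists l : T -> E, [/\ continuous l, forall t, q (l t) = k t & l t0 = e].
Proof.
move=> [oU [V [oV _ UV VU]]] ck Uk qe.
have : (q @^-1` U) e by rewrite /= qe.
rewrite -UV => -[W VW We]; have [[_ iW sW] qW] := VU W VW.
have /choice[l lE] t : exists w, W w /\ q w = k t by have [w] := sW _ (Uk t); exists w.
exists l; split=> [t O /= nO|t|]; last 2 first.
- by have [] := lE t.
- by have [Wl ql] := lE t0; apply: iW; rewrite ?inE // ql.
have [O' [oO' O't] O'O] : exists2 O', open_nbhs (l t) O' & O' `<=` O.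
  by move: nO; rewrite nbhsE => -[O' ? ?]; exists O'.
have /qW : open (O' `&` W) by apply: openI => //; exact: oV.
move=> /(_ (@subIsetr _ _ _)) oq.
have : \near t, (q @` (O' `&` W)) (k t).
  apply: ck; apply: open_nbhs_nbhs; split=> //; exists (l t); last by case: (lE t).
  by split=> //; case: (lE t).
change (nbhs t (fun t' => (q @` (O' `&` W)) (k t')) -> nbhs t (fun t' => O (l t'))).
apply: filterS => t' [w [O'w Ww] qw]; apply: O'O.
by have [Wl ql] := lE t'; rewrite (_ : l t' = w) //; apply: iW; rewrite ?inE // ql.
Qed.

(** For [a <= b] and [c <= d], the retraction of the plane onto a rectangle. *)
Definition box (a b c d : R) (z : R * R) : R * R :=
  (Num.max a (Num.min z.1 b), Num.max c (Num.min z.2 d)).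

(** Lifting [K] composed with the retraction gives total maps on the plane, which can be glued
    without subspace topologies. *)
Definition lifts_on (K : R * R -> X) (a b c d : R) : Prop :=
  forall e, q e = K (a, c) ->
  exists L : R * R -> E,
    [/\ continuous L, forall z, q (L z) = K (box a b c d z) & L (a, c) = e].

Lemma connectedR : connected [set: R].
Proof. by apply/connected_intervalP. Qed.

(** The second lift starts at the point that the first one reaches at [(m, c)]; by uniqueness of
    lifts the two then agree on the whole line over [m]. *)
Lemma lifts_on_glue K a m b c d : a <= m -> m <= b -> c <= d ->
  lifts_on K a m c d -> lifts_on K m b c d -> lifts_on K a b c d.
Proof.
move=> am mb cd K1 K2 e /K1[L1 [cL1 qL1 L1e]].
have /K2[L2 [cL2 qL2 L2e]] : q (L1 (m, c)) = K (m, c).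
  by rewrite qL1 /box /= minxx (max_idPr am) (min_idPl cd) maxxx.
have cpair (L : R * R -> E) : continuous L -> continuous (fun v => L (m, v)).
  move=> cL; apply: (continuous_compT cL); apply: continuous_pairT.
    exact: continuous_cstT.
  by move=> v; exact: cvg_id.
have L12 v : L1 (m, v) = L2 (m, v).
  apply: (lift_unique (t0 := c) connectedR (cpair _ cL1) (cpair _ cL2)) => //.
  by move=> t; rewrite qL1 qL2 /box /= minxx (max_idPr am) (min_idPl mb) maxxx.
(* The shift by [1 - m] moves the seam to the threshold 1 of [continuous_glue]. *)
exists (fun z => if z.1 + (1 - m) <= 1 then L1 z else L2 z); split.
- apply: continuous_glue => //.
    by apply: continuous_addT; [exact: continuous_fst|exact: continuous_cstT].
  move=> [u v] /= um; have -> : u = m by lra.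
  exact: L12.
- move=> z; case: ifPn => zm.
    rewrite qL1 /box (min_idPl (_ : z.1 <= m)); last by lra.
    by rewrite (min_idPl (_ : z.1 <= b)) //; lra.
  rewrite qL2 /box; have mz : m <= Num.min z.1 b by rewrite le_min mb andbT; lra.
  by rewrite (max_idPr mz) (max_idPr (le_trans am mz)).
- by rewrite /= ifT // ; lra.
Qed.

Lemma lifts_on_swap K K' a b c d : (forall u v, K' (v, u) = K (u, v)) ->
  lifts_on K' c d a b -> lifts_on K a b c d.
Proof.
move=> K'K lK' e; rewrite -K'K => /lK'[L [cL qL Le]].
exists (fun z => L (z.2, z.1)); split=> //.
  apply: (continuous_compT cL); apply: continuous_pairT.
    exact: continuous_snd.
  exact: continuous_fst.
by move=> z; rewrite qL; exact: K'K.
Qed.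

(** Compactness of the square in its near-covering form: it suffices that the bound holds for all
    points near a given one and all large [n]. *)
Lemma lebesgue_number (K : R * R -> X) : continuous K ->
  exists n : nat, forall x : R * R, 0 <= x.1 <= 1 -> 0 <= x.2 <= 1 ->
    exists2 U, evenly_covered U &
      forall y : R * R, `|x.1 - y.1| <= n.+1%:R^-1 -> `|x.2 - y.2| <= n.+1%:R^-1 ->
        U (K y).
Proof.
move=> cK.
pose P (n : nat) (x : R * R) := exists2 U, evenly_covered U &
  forall y : R * R, `|x.1 - y.1| <= n.+1%:R^-1 -> `|x.2 - y.2| <= n.+1%:R^-1 -> U (K y).
have /compact_near_coveringP Icompact : compact (`[0 : R, 1] `*` `[0 : R, 1]).
  by apply: compact_setX; exact: segment_compact.
have [|N _ NP] := Icompact nat \oo P _ _; last first.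
  exists N => -[u v] u01 v01; apply: (NP N (leqnn N)).
  by split; rewrite /= in_itv.
move=> x _; have [U eU Ux] := evenly_covered_nbhd (K x).
have : nbhs x (K @^-1` U) by apply: cK; apply: open_nbhs_nbhs; split=> //; case: eU.
move=> [[A B] [/nbhs_ballP[e1 /= e1_gt0 e1A] /nbhs_ballP[e2 /= e2_gt0 e2B]] ABU].
(* Half the radius: one [e] for the distance from [x] to [x'], one for that from [x'] to [y]. *)
pose e := Num.min e1 e2 / 2.
have e_gt0 : 0 < e by rewrite divr_gt0 // lt_min e1_gt0 e2_gt0.
have e1e : e + e <= e1 by rewrite -splitr ge_min lexx.
have e2e : e + e <= e2 by rewrite -splitr ge_min lexx orbT.
have xe : \forall z \near x, `|x.1 - z.1| < e /\ `|x.2 - z.2| < e.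
  exists (ball x.1 e, ball x.2 e); last by move=> [u v] [].
  by split; exact: nbhsx_ballx.
near=> x' n; exists U => // y /= xy1 xy2.
have ne : n.+1%:R^-1 < e by near: n; exact: near_infty_natSinv_lt (PosNum e_gt0).
have [x1 x2] : `|x.1 - x'.1| < e /\ `|x.2 - x'.2| < e by near: x'.
apply: (ABU y); split; [apply: e1A|apply: e2B].
- apply: (le_lt_trans (ler_distD x'.1 _ _)); apply: (lt_le_trans _ e1e).
  by rewrite ltrD // (le_lt_trans xy1).
- apply: (le_lt_trans (ler_distD x'.2 _ _)); apply: (lt_le_trans _ e2e).
  by rewrite ltrD // (le_lt_trans xy2).
Unshelve. all: by end_near. Qed.

Lemma subdivision_ind (n : nat) (Q : R -> R -> Prop) :
  (forall a b, 0 <= a <= 1 -> a <= b -> b <= a + n.+1%:R^-1 -> Q a b) ->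
  (forall a m b, a <= m -> m <= b -> Q a m -> Q m b -> Q a b) ->
  Q 0 1.
Proof.
move=> Qsmall Qglue; set d : R := n.+1%:R^-1.
have d_gt0 : 0 < d by rewrite invr_gt0 ltr0n.
have nd : n.+1%:R * d = 1 by rewrite divff // pnatr_eq0.
suff Qi i : (i <= n.+1)%N -> Q 0 (i%:R * d) by rewrite -nd; exact: Qi.
elim: i => [_|i IHi ile].
  by apply: Qsmall; rewrite ?mul0r ?lexx ?ler01 ?add0r //; exact: ltW.
have id_ge0 : 0 <= i%:R * d by rewrite mulr_ge0 // ltW.
have idS : i.+1%:R * d = i%:R * d + d by rewrite -natr1 mulrDl mul1r.
apply: (Qglue _ (i%:R * d)) => //.
- by rewrite idS lerDl ltW.
- exact/IHi/ltnW.
- apply: Qsmall; rewrite ?idS ?lexx ?lerDl ?id_ge0 ?(ltW d_gt0) //=.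
  by rewrite -[leRHS]nd ler_pM2r // ler_nat ltnW.
Qed.

(** Small rectangles map into evenly covered sets. They are glued in the first coordinate into
    strips, and after exchanging the coordinates the strips are glued in the second. *)
Lemma homotopy_lift (K : R * R -> X) : continuous K -> lifts_on K 0 1 0 1.
Proof.
move=> cK; have [n Kn] := lebesgue_number cK.
have near_corner (a b u : R) : a <= b -> b <= a + n.+1%:R^-1 ->
    `|a - Num.max a (Num.min u b)| <= n.+1%:R^-1.
  move=> ab ba; rewrite distrC ger0_norm ?subr_ge0 ?le_max ?lexx // lerBlDl.
  by rewrite ge_max (le_trans ab ba) ge_min ba orbT.
have small a b c d : 0 <= a <= 1 -> 0 <= c <= 1 -> a <= b -> b <= a + n.+1%:R^-1 ->
    c <= d -> d <= c + n.+1%:R^-1 -> lifts_on K a b c d.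
  move=> a01 c01 ab ba cd dc e qe; have [U eU KU] := Kn (a, c) a01 c01.
  have cbox : continuous (box a b c d).
    by apply: continuous_pairT; apply: continuous_maxT;
      [exact: continuous_cstT| |exact: continuous_cstT|];
      apply: continuous_minT; try exact: continuous_cstT;
      [exact: continuous_fst|exact: continuous_snd].
  apply: (lift_evenly_covered (k := fun z => K (box a b c d z)) eU).
  - exact: (continuous_compT cK cbox).
  - by move=> z; apply: KU; exact: near_corner.
  - by rewrite qe /box /= (min_idPl ab) (min_idPl cd) !maxxx.
pose K' (z : R * R) := K (z.2, z.1).
apply: (@lifts_on_swap _ K') => //.
apply: (@subdivision_ind n (fun c d => lifts_on K' c d 0 1)).
  move=> c d c01 cd dc; apply: (@lifts_on_swap _ K) => //.
  apply: (@subdivision_ind n (fun a b => lifts_on K a b c d)).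
    by move=> a b a01 ab ba; exact: small.
  by move=> a m b am mb; exact: lifts_on_glue.
by move=> c m d cm md; exact: lifts_on_glue.
Qed.

End Lifting.

(** A homotopy between the images of two loops lifts to the cover, and uniqueness of lifts shows
    that the lift is a homotopy between the loops themselves. *)
Lemma pi1_map_injective (R : realType) (E X : topologicalType) (e : E) (x : X)
    (q : continuousType E X) (qe : q e = x) :
  covering_map q -> injective (pi1_map R q qe).
Proof.
move=> q_cover u v.
have [a ->] := pi1_repr u; have [b ->] := pi1_repr v.
rewrite !pi1_mapE => /pi1_classP[H [cH H0 H1 Hz Ho]]; apply/pi1_classP.
pose K (z : R * R) := H (clamp z.1, clamp z.2).
have cc1 : continuous (fun z : R * R => clamp z.1).
  exact: (continuous_compT (@continuous_clamp R) (@continuous_fst _ _)).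
have cc2 : continuous (fun z : R * R => clamp z.2).
  exact: (continuous_compT (@continuous_clamp R) (@continuous_snd _ _)).
have cK : continuous K.
  exact: (continuous_compT cH (continuous_pairT cc1 cc2)).
have [|L [cL qL L0]] := homotopy_lift q_cover cK (e := e).
  by rewrite /K [RHS]H0 /= path_zero.
(* [K] already clamps its arguments, so the retraction onto the unit square changes nothing. *)
have {}qL z : q (L z) = K z.
  by rewrite qL /K /box /= -!ivalE !ivalK.
have cL1 w : continuous (fun v => L (w, v)).
  apply: (continuous_compT cL); apply: continuous_pairT.
    exact: continuous_cstT.
  by move=> ?; exact: cvg_id.
have cL2 w : continuous (fun v => L (v, w)).
  apply: (continuous_compT cL); apply: continuous_pairT.
    by move=> ?; exact: cvg_id.
  exact: continuous_cstT.
have lift_eq := lift_unique q_cover (t0 := 0) (@connectedR R).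
(* The four sides are identified in turn: those through [(0, 0)] start at [e], and each of the other
   two starts at the end of a side already known. *)
have L0v w : L (0, w) = extend a w.
  apply: (lift_eq (fun w => L (0, w)) (extend a)) => //.
    exact/continuous_extend/cts_fun.
    by move=> t; rewrite qL /K /= [LHS]H0.
  by rewrite L0 extend_le0 // path_zero.
have Lv0 w : L (w, 0) = e.
  apply: (lift_eq (fun w => L (w, 0)) (fun=> e)) => //; first exact: continuous_cstT.
  by move=> t; rewrite qL /K /= [LHS]Hz /= path_zero.
have L1v w : L (1, w) = extend b w.
  apply: (lift_eq (fun w => L (1, w)) (extend b)) => //.
    exact/continuous_extend/cts_fun.
    by move=> t; rewrite qL /K /= [LHS]H1.
  by rewrite Lv0 extend_le0 // path_zero.
have Lv1 w : L (w, 1) = e.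
  apply: (lift_eq (fun w => L (w, 1)) (fun=> e)) => //; first exact: continuous_cstT.
    by move=> t; rewrite qL /K /= [LHS]Ho /= path_one.
  by rewrite L0v extend_ge1 // path_one.
exists (fun z => L (ival z.1, ival z.2)); split=> /= [|t|t|t|t].
- apply: (continuous_compT cL); apply: continuous_pairT.
    exact: (continuous_compT (@continuous_ival R) (@continuous_fst _ _)).
  exact: (continuous_compT (@continuous_ival R) (@continuous_snd _ _)).
- by rewrite ival0 L0v extend_ival.
- by rewrite ival1 L1v extend_ival.
- by rewrite ival0 Lv0 path_zero.
- by rewrite ival1 Lv1 path_one.
Qed.

(** * Climbing the tower of covers *)

Section PTower.
Context (R : realType).

Lemma pi1_map_square (X Y X' Y' : topologicalType) (x : X) (y : Y) (x' : X') (y' : Y')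
    (f : continuousType X Y) (g : continuousType Y Y')
    (f' : continuousType X X') (g' : continuousType X' Y')
    (fx : f x = y) (gy : g y = y') (fx' : f' x = x') (gx' : g' x' = y') (u : pi1 R x) :
  (forall t, g (f t) = g' (f' t)) ->
  pi1_map R g gy (pi1_map R f fx u) = pi1_map R g' gx' (pi1_map R f' fx' u).
Proof.
move=> gf; have [a ->] := pi1_repr u; rewrite !pi1_mapE; congr pi1_class.
by apply/path_eqP => t; exact: gf.
Qed.

(** Being a pro-p equivalence is the invariant of the induction: the covers have as fundamental
    groups the kernels of corresponding surjections, so their lift is again one. Spaces and base
    points vary because the induction hypothesis is applied to the covers. *)
Lemma p_tower_map_upto_pro_p (p n : nat) (X Y : topologicalType) (x : X) (y : Y)
    (f : continuousType X Y) (fx : f x = y) :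
  pro_p_equivalence p (pi1_map R f fx) -> p_tower_map_upto R p n fx.
Proof.
elim: n X Y x y f fx => [|n IHn] X Y x y f fx f_eq; split=> //.
- by move=> G /andP[_ pG]; exact: f_eq.
- by move=> G /andP[_ pG]; exact: f_eq.
move=> G phi pG phi_surj Y1 y1 q qy [q_cover _ q_ker] X1 x1 r rx [r_cover _ r_ker].
move=> f1 f1x qf1; apply: IHn.
apply: (pro_p_equivalence_kernel f_eq pG phi_surj (j := pi1_map R q qy)
  (i := pi1_map R r rx)).
- exact: pi1_map_injective.
- exact: pi1_map_injective.
- exact: r_ker.
- exact: q_ker.
- by move=> u; exact: pi1_map_square.
Qed.

End PTower.

Theorem proposition1p2 (R : realType) (p : nat) (p_prime : prime p)
  (X Y : topologicalType)
  (X_connected : connected [set: X]) (Y_connected : connected [set: Y])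
  (X_CW : finite_CW_type R X) (Y_CW : finite_CW_type R Y)
  (f : continuousType X Y) (x : X)
  (A B : groupType)
  (iX : {multiplicative pi1 R x -> A}) (iY : {multiplicative pi1 R (f x) -> B})
  (A_closure : algebraic_closure p iX) (B_closure : algebraic_closure p iY)
  (fhat : {multiplicative A -> B})
  (fhat_induced : forall u : pi1 R x,
     fhat (iX u) = iY (pi1_map R f (erefl (f x)) u))
  (fhat_iso : bijective fhat) :
  p_tower_map R p x f.
Proof.
move=> n; apply: p_tower_map_upto_pro_p.
exact: pro_p_equivalence_closure p_prime A_closure B_closure fhat_induced fhat_iso.
Qed.
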